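(* Every $10$-tough chordal graph $G$ is Hamilton-connected, i.e., for any two vertices $u,v$ of $G$ there is a Hamilton path of $G$ from $u$ to $v$.
   Context: A graph is chordal if it has no induced cycle of length at least $4$. The toughness of a non-complete graph $G$ is the minimum, over all separating sets $S\subseteq V(G)$ (sets whose removal leaves a disconnected graph), of $|S|/c(G-S)$, where $c(G-S)$ is the number of components of $G-S$; the toughness of a complete graph is defined to be $\infty$. A graph is $t$-tough if its toughness is at least $t$. *)

(* Defs.v *)
From mathcomp Require Import all_boot all_order all_algebra.
From mathcomp Require Import constructive_ereal.

Set Implicit Arguments.
Unset Strict Implicit.
Unset Printing Implicit Defensive.

Import Order.TTheory GRing.Theory Num.Theory.

Section Graphs.

(* A finite simple graph on T is a symmetric irreflexive relation e : rel T;
   these two properties are hypotheses of the theorem. *)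
Variables (T : finType) (e : rel T).

(* c lists the vertices of a cycle in cyclic order, without repetition, and the
   only edges among them are those between cyclically consecutive vertices. *)
Definition induced_cycle (c : seq T) : Prop :=
  ucycle e c /\
  {in c &, forall x y, e x y -> y = next c x \/ x = next c y}.

Definition chordal : Prop :=
  ~ exists c : seq T, induced_cycle c /\ 4 <= size c.

Definition complete_graph : bool :=
  [forall x, forall y, (x != y) ==> e x y].

Definition del_vertices (S : {set T}) : rel T :=
  [rel x y | [&& x \notin S, y \notin S & e x y]].

(* n_comp counts only the components inside ~: S, so the vertices of S, which
   are isolated in del_vertices S, do not contribute. *)
Definition components_del (S : {set T}) : nat :=
  n_comp (del_vertices S) (~: S).

Definition separating (S : {set T}) : bool := 1 < components_del S.

(* A non-complete graph has a separating set, so the neutral element +oo of the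
   minimum is never the value of the second branch. *)
Definition toughness : \bar rat :=
  if complete_graph then +oo%E
  else \big[Order.min/+oo%E]_(S : {set T} | separating S)
         ((#|S|%:R / (components_del S)%:R)%R%:E).

Definition tough (t : rat) : Prop := (t%:E <= toughness)%E.

Definition hamilton_path (u v : T) (p : seq T) : Prop :=
  [/\ path e u p, last u p = v, uniq (u :: p) & forall x, x \in u :: p].

Definition hamilton_connected : Prop :=
  forall u v : T, u != v -> exists p : seq T, hamilton_path u v p.

End Graphs.

(* Main.v *)
(** A chordal graph has an elimination order that ends in a clique [K], the
closed neighbourhood of a simplicial vertex [s].  It gives a tree, rooted at
[s], whose nodes [x] carry clique bags such that the bags containing a fixed
vertex form a subtree.  Mark the root, the leaves, the branching nodes, and as
few and as low further nodes as needed for every vertex to lie in a marked bag.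

Call a pair of equal or adjacent vertices, one in the bag of a mark and one in
that of the next mark above it, a linkage of the lower mark.  If every mark has
two linkages, all of them disjoint and avoiding the vertices [u] and [v], then
the linkages can be strung together along the tree to a path from [u] to [v]
with an edge inside each marked bag, and all the remaining vertices can be
inserted at these edges.

Such linkages exist by a Hall-type theorem for hypergraphs of rank 2, proved by
Haxell's alternating argument: it suffices that no set of at most 5j-3 vertices
meets all linkages of j marks.  A set meeting all linkages of j marks contains
the separators of j tree edges, one between each of these marks and the next
one.  Sweeping up the tree one selects at least half of these edges so that
every part of the tree cut along them still contains the whole subtree of some
vertex.  Their separators thus leave at least j/2+1 components, and 10-toughness
shows that the set has at least 5j+10 vertices. *)

Require Import Defs.
From mathcomp Require Import all_boot all_order all_algebra.
From mathcomp Require Import constructive_ereal zify.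

Set Implicit Arguments.
Unset Strict Implicit.
Unset Printing Implicit Defensive.

(** * Simplicial vertices of chordal graphs *)

(** A path of least length works: a repeated vertex or a forward chord would shorten it. *)
Lemma chordless_path (T : finType) (r : rel T) (x y : T) :
  connect r x y ->
  exists p, [/\ path r x p, last x p = y, uniq (x :: p) &
    forall i j, i < j <= size p ->
      r (nth x (x :: p) i) (nth x (x :: p) j) -> j = i.+1].
Proof.
move=> /connectP[p0 rp0 yp0].
have exn : exists n, [exists p : n.-tuple T, path r x p && (last x p == y)].
  by exists (size p0); apply/existsP; exists (in_tuple p0); rewrite /= rp0 yp0 eqxx.
case: (ex_minnP exn) => n /existsP[[p /= /eqP sz] /andP[rp /eqP yp]] minn.
have {}minn q : path r x q -> last x q = y -> size p <= size q.
  move=> rq yq; rewrite sz; apply: minn; apply/existsP; exists (in_tuple q).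
  by rewrite /= rq yq eqxx.
exists p; split=> //.
  case/shortenP: (rp) yp => q rq uq sub_qp yq.
  have /andP[xq uq'] := uq; have le_pq := minn q rq yq.
  have [_ eq_qp] := uniq_min_size uq' sub_qp le_pq.
  by rewrite /= -eq_qp xq (leq_size_uniq uq' sub_qp le_pq).
move=> i j /andP[ij jp] rij; apply/eqP; rewrite eqn_leq ij andbT leqNgt.
apply/negP=> ij2.
case: j => // j in ij jp rij ij2 *.
have j_p : j < size p by [].
have rj : path r (nth x (x :: p) j.+1) (drop j.+1 p).
  move: rp; rewrite -{1}(cat_take_drop j.+1 p) cat_path => /andP[_].
  by rewrite (last_nth x) size_takel // -[nth x (x :: _) _]/(nth x (take _ _) j)
    nth_take.
have ri : path r x (take i p).
  by move: rp; rewrite -{1}(cat_take_drop i p) cat_path => /andP[].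
have li : last x (take i p) = nth x (x :: p) i.
  rewrite (last_nth x) size_takel; last by lia.
  by case: (i) => //= i'; rewrite nth_take.
have := minn (take i p ++ nth x (x :: p) j.+1 :: drop j.+1 p).
rewrite cat_path ri li /= rij rj /= => /(_ isT); rewrite last_cat /=.
have -> : last (nth x p j) (drop j.+1 p) = y.
  rewrite -yp -[in RHS](cat_take_drop j.+1 p) last_cat; congr (last _ _).
  by rewrite (last_nth x) size_takel //= nth_take.
by move=> /(_ erefl); rewrite size_cat /= size_drop size_takel; lia.
Qed.

Section Dirac.

Variables (T : finType) (e : rel T).
Hypotheses (e_sym : symmetric e) (e_irr : irreflexive e).
Hypothesis e_chordal : chordal e.

Definition clique (A : {set T}) : Prop :=
  {in A &, forall x y, x != y -> e x y}.

Lemma clique_sub (A B : {set T}) : A \subset B -> clique B -> clique A.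
Proof. by move=> /subsetP AB cB x y /AB xB /AB; apply: cB. Qed.

(* Otherwise a chordless path from [x] to [y] closes up with [a] to an induced
   cycle of length at least 4. *)
Lemma common_neighbors_adj (a x y : T) (D : {set T}) :
  e a x -> e a y -> x != y -> {in D, forall z, ~~ e a z} -> a \notin D ->
  connect [rel u v | [&& u \in x |: (y |: D), v \in x |: (y |: D) & e u v]] x y ->
  e x y.
Proof.
set D' := x |: (y |: D) => ax ay xy aD aND /chordless_path[p [rp yp up cp]].
apply: contraT => nexy; case: e_chordal.
have pD' : {subset x :: p <= D'}.
  move=> z; rewrite inE => /predU1P[->|zp]; first by rewrite !inE eqxx.
  case/splitPr: zp rp => p1 p2; rewrite cat_path /=.
  by case/and3P=> _ /and3P[].
have aD' z : z \in D' -> e a z -> z = x \/ z = y.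
  by rewrite !inE => /or3P[/eqP|/eqP|/aD/negPf->]; [left|right|].
have ap : a \notin x :: p.
  apply/negP=> /pD'; rewrite !inE (negPf aND) orbF => /orP[]/eqP ax'.
    by rewrite ax' e_irr in ax.
  by rewrite ax' e_irr in ay.
have uc : uniq (a :: x :: p) by rewrite cons_uniq ap.
exists (a :: x :: p); split; last first.
  case: p => [|b [|c p]] //= in rp yp {up cp pD' ap uc} *.
    by rewrite yp eqxx in xy.
  by move: nexy; rewrite -yp; move: rp => /andP[/and3P[_ _ ->]].
split.
  rewrite /ucycle uc andbT /= ax rcons_path yp e_sym ay andbT.
  by apply: sub_path rp => u v /= /and3P[].
have nexta : next (a :: x :: p) a = x by rewrite /= eqxx.
have nexty : next (a :: x :: p) y = a.
  rewrite next_nth -{1}yp inE mem_last orbT.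
  have -> : index y (a :: x :: p) = (size p).+1.
    rewrite -{1}yp (last_nth x) -[nth x _ _]/(nth x (a :: x :: p) (size p).+1).
    by rewrite index_uniq //=.
  by rewrite nth_default.
have nexti i : i < size p ->
    next (a :: x :: p) (nth x (x :: p) i) = nth x (x :: p) i.+1.
  move=> ip; have ip' : i < size (x :: p) by apply: leq_trans ip _.
  have idx : index (nth x (x :: p) i) (a :: x :: p) = i.+1.
    by rewrite -[nth x (x :: p) i]/(nth x (a :: x :: p) i.+1) index_uniq.
  rewrite next_nth inE mem_nth // orbT idx; exact: set_nth_default.
have ind u v : u \in x :: p -> v \in x :: p -> e u v ->
    v = next (a :: x :: p) u \/ u = next (a :: x :: p) v.
  move=> /[dup] /pD' uD' /(nthP x)[i si <-] /[dup] /pD' vD' /(nthP x)[j sj <-] euv.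
  have uD := pD' _ (mem_nth x si); have vD := pD' _ (mem_nth x sj).
  case: (ltngtP i j) => ij.
  - have ji : j = i.+1 by apply: cp; [rewrite ij|apply/and3P].
    by left; rewrite ji nexti // -ltnS -ji.
  - have ji : i = j.+1 by apply: cp; [rewrite ij|apply/and3P; rewrite e_sym].
    by right; rewrite ji nexti // -ltnS -ji.
  - by rewrite ij e_irr in euv.
move=> u v; rewrite 2!(in_cons a) => /predU1P[->|uP] /predU1P[->|vP].
- by rewrite e_irr.
- move=> /(aD' _ (pD' _ vP))[]->; first by left.
  by right.
- rewrite e_sym => /(aD' _ (pD' _ uP))[]->; first by right.
  by left.
- exact: ind.
Qed.

(** Dirac's theorem relative to a clique, by induction on [U]. Unless [U] is a clique, it has
    non-adjacent [a] and [b] with [K] in the closed neighbourhood of [a]. Let [C] be the component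
    of [b] among the non-neighbours of [a], and [S] its boundary in [U]. Then [S] is a clique, and
    induction on [C :|: S] relative to [S] gives a vertex of [C]. Its neighbours in [U] lie in
    [C :|: S], and it is not in [K] because [a] is not adjacent to it. *)
Lemma simplicial_exists (U K : {set T}) :
  K \proper U -> clique K ->
  exists2 z, z \in U :\: K & clique [set w in U | e z w].
Proof.
have [n] := ubnP #|U|; elim: n U K => // n IHn U K; rewrite ltnS => cU KU cK.
have [/forall_inP univ|] := boolP [forall a in U, forall b in U, (a != b) ==> e a b].
  have /properP[_ [z zU zK]] := KU; exists z; first by rewrite inE zK.
  move=> x y; rewrite !inE => /andP[xU _] /andP[yU _] xy.
  by have /forall_inP/(_ y yU)/implyP/(_ xy) := univ x xU.
rewrite negb_forall_in => /exists_inP[a0 a0U].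
rewrite negb_forall_in => /exists_inP[b0 b0U]; rewrite negb_imply => na0b0.
(* A vertex of [K] with a non-neighbour in [U] can serve as [a]; without one, any non-adjacent pair
   will do. *)
have [a [b [aU bU ab nab Ka]]] : exists a b,
    [/\ a \in U, b \in U, a != b, ~~ e a b & forall z, z \in K -> z != a -> e a z].
  have [/exists_inP[a aK /exists_inP[b bU /andP[ab nab]]]|] :=
      boolP [exists a in K, exists b in U, (a != b) && ~~ e a b].
    exists a, b; split=> //; first exact: (subsetP (proper_sub KU)).
    by move=> z zK za; apply: cK; rewrite // eq_sym.
  rewrite negb_exists_in => /forall_inP Kuniv.
  case/andP: na0b0 => ab nab; exists a0, b0; split=> // z zK za.
  have := Kuniv z zK; rewrite negb_exists_in => /forall_inP/(_ a0 a0U).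
  by rewrite za /= negbK e_sym.
pose D := [set z in U | (z != a) && ~~ e a z].
pose r0 := [rel u v | [&& u \in D, v \in D & e u v]].
pose C := [set z | connect r0 b z].
have bD : b \in D by rewrite inE bU eq_sym ab.
have CD : C \subset D.
  apply/subsetP=> z; rewrite inE => /connectP[p].
  elim/last_ind: p z => [|p c _] z /=; first by move=> _ ->.
  by rewrite rcons_path last_rcons => /andP[_ /and3P[_ cD _]] ->.
have r0_sym : connect_sym r0.
  by apply: sym_connect_sym => u v; rewrite /= e_sym andbCA.
pose S := [set x in U | (x \notin C) && [exists c in C, e c x]].
have CU : C \subset U.
  by apply: subset_trans CD _; apply/subsetP=> z; rewrite inE => /andP[].
have SC c x : c \in C -> x \in U -> e c x -> x \in C :|: S.
  move=> cC xU ecx; rewrite !inE; case: (boolP (connect _ _ _)) => //= _.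
  by rewrite xU; apply/exists_inP; exists c.
have Sa x : x \in S -> e a x.
  rewrite !inE => /and3P[xU nbx /exists_inP[c cC ecx]].
  have cD := subsetP CD c cC.
  have xa : x != a.
    by apply: contraTneq cD => xa; rewrite inE -xa [e x c]e_sym ecx !andbF.
  apply: contraNT nbx => nax; move: (cC); rewrite inE => bc.
  by apply: connect_trans bc (connect1 _); rewrite /= cD ecx inE xU xa nax.
(* Two vertices of [S] are neighbours of [a] joined by a path through [C], so chordality makes them
   adjacent. *)
have cS : clique S.
  move=> x y xS yS xy.
  apply: (@common_neighbors_adj a x y D) => //; try exact: Sa.
  - by move=> z; rewrite inE => /and3P[].
  - by rewrite inE eqxx andbF.
  move: xS yS; rewrite !inE => /and3P[_ _ /exists_inP[c]].
  rewrite inE => bc ecx /and3P[_ _ /exists_inP[d]]; rewrite inE => bd edy.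
  have cD : c \in D by apply: (subsetP CD); rewrite inE.
  have dD : d \in D by apply: (subsetP CD); rewrite inE.
  set r := [rel u v | _].
  have cd : connect r0 c d by apply: connect_trans bd; rewrite r0_sym.
  apply: (@connect_trans _ _ c).
    by apply: connect1; rewrite /= e_sym ecx !inE eqxx;
      move: cD; rewrite !inE => ->; rewrite !orbT.
  apply: (@connect_trans _ _ d); last first.
    apply: connect1; rewrite /= edy !inE eqxx.
    by move: dD; rewrite !inE => ->; rewrite !orbT.
  apply: connect_sub cd => u v /= /and3P[uD vD euv]; apply: connect1.
  by rewrite /= euv; move: uD vD; rewrite !inE => -> ->; rewrite !orbT.
have aCS : a \notin C :|: S.
  rewrite inE negb_or; apply/andP; split.
    by apply/negP=> /(subsetP CD); rewrite inE eqxx andbF.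
  by apply/negP=> /Sa; rewrite e_irr.
have CSU : C :|: S \proper U.
  apply/properP; split; last by exists a.
  by rewrite subUset CU; apply/subsetP=> z; rewrite inE => /andP[].
have SCS : S \proper C :|: S.
  apply/properP; split; first exact: subsetUr.
  by exists b; rewrite !inE ?connect0 ?andbF ?bU.
have [z zCS cz] := IHn _ _ (leq_trans (proper_card CSU) cU) SCS cS.
have zC : z \in C by move: zCS; rewrite !inE => /andP[/negPf-> ]; rewrite orbF.
exists z.
  rewrite inE (subsetP CU) // andbT; apply/negP=> zK.
  have := subsetP CD z zC; rewrite inE => /and3P[_ za].
  by rewrite (Ka z zK za).
apply: clique_sub cz; apply/subsetP=> w; rewrite inE => /andP[wU ezw].
by rewrite inE ezw andbT; apply: SC ezw.
Qed.

(** Simplicial vertices outside [K] are removed one by one, and the rank is the position in the list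
    [l] of removals. The induction runs over all sets [U] containing [K]. *)
Lemma elimination_order (K : {set T}) :
  clique K ->
  exists rk : T -> nat, exists n,
    [/\ forall x, rk x <= n, forall x, (rk x < n) = (x \notin K),
        {in ~: K &, injective rk} &
        forall x, x \notin K -> clique [set y | e x y & rk x < rk y]].
Proof.
move=> cK.
suff [l [ul ml cl]] : exists l : seq T, [/\ uniq l,
    forall x, (x \in l) = (x \in [set: T] :\: K) &
    forall x, x \in l ->
      clique [set y in [set: T] | e x y & index x l < index y l]].
  (* [index] returns the length of [l] for vertices not in [l], so all of [K] gets the top rank. *)
  exists (index^~ l), (size l); split=> [x|x|x y xK yK|x xK].
  - exact: index_size.
  - by rewrite index_mem ml !inE andbT.
  - have xl : x \in l by rewrite ml setTD.
    have yl : y \in l by rewrite ml setTD.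
    by move=> exy; rewrite -(nth_index x xl) exy nth_index.
  - have /cl : x \in l by rewrite ml !inE xK.
    by apply: clique_sub; apply/subsetP=> y; rewrite !inE.
move: (subsetT K); move: [set: T] => U.
have [n] := ubnP #|U|; elim: n U => // n IHn U; rewrite ltnS => cU KU.
have [->|neqKU] := eqVneq U K.
  by exists [::]; split=> // x; rewrite setDv inE.
have [|z zUK cz] := @simplicial_exists U K _ cK.
  by rewrite properEneq eq_sym neqKU.
have /setDP[zU zK] := zUK.
have [||l [ul ml cl]] := IHn (U :\ z).
- by apply: leq_trans cU; rewrite [X in _ < X](cardsD1 z) zU.
- by apply/subsetD1P.
exists (z :: l); split=> [|x|x].
- by rewrite /= ul ml !inE eqxx andbF.
- rewrite inE ml !inE; case: eqP => // ->; by rewrite zK zU.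
- rewrite inE => /predU1P[->|xl].
    by apply: clique_sub cz; apply/subsetP=> y; rewrite !inE => /and3P[-> ->].
  have zx : z != x by apply: contraTneq xl => <-; rewrite ml !inE eqxx andbF.
  apply: clique_sub (cl x xl); apply/subsetP=> y; rewrite !inE /= (negPf zx).
  by rewrite [z == y]eq_sym; case: eqP => //= _; rewrite ltn0 !andbF.
Qed.

End Dirac.

(** * Disjoint representatives *)

Section DoubleRepresentatives.

Variables (I V : finType) (E : I -> {set V} -> Prop).
Hypothesis E_card : forall i g, E i g -> 0 < #|g| <= 2.
Hypothesis E_free : forall (J : {set I}) (W : {set V}),
  J != set0 -> #|W| + 3 <= 5 * #|J| ->
  exists i g, [/\ i \in J, E i g & [disjoint g & W]].

(* The value [set0] of a slot means that the slot is still unassigned. *)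
Definition assignment (A : {ffun I * bool -> {set V}}) : Prop :=
  (forall k, A k != set0 -> E k.1 (A k)) /\
  (forall k l, k != l -> [disjoint A k & A l]).

Definition load (A : {ffun I * bool -> {set V}}) (i : I) : {set V} :=
  A (i, true) :|: A (i, false).

Lemma sub_load (A : {ffun I * bool -> {set V}}) k : A k \subset load A k.1.
Proof. by case: k => i [] /=; rewrite ?subsetUl ?subsetUr. Qed.

Lemma card_slot (A : {ffun I * bool -> {set V}}) k : assignment A -> #|A k| <= 2.
Proof.
case=> AE _; have [->|/AE/E_card/andP[]//] := eqVneq (A k) set0.
by rewrite cards0.
Qed.

Lemma card_load (A : {ffun I * bool -> {set V}}) i : assignment A -> #|load A i| <= 4.
Proof.
move=> Aok; apply: leq_trans (leq_card_setU _ _).1 _.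
by rewrite (leq_add (card_slot (i, true) Aok) (card_slot (i, false) Aok)).
Qed.

Definition reassign (A : {ffun I * bool -> {set V}}) k0 g :=
  [ffun k => if k == k0 then g else A k].

Lemma assignment_reassign (A : {ffun I * bool -> {set V}}) k0 g :
  assignment A -> E k0.1 g -> (forall k, [disjoint g & A k]) ->
  assignment (reassign A k0 g).
Proof.
move=> [AE Adis] Eg gdis; split=> [k|k l kl]; rewrite !ffunE.
  by case: (k =P k0) => [-> _|_] //; apply: AE.
case: (eqVneq k k0) => [kk0|_]; case: (eqVneq l k0) => [lk0|_].
- by rewrite kk0 lk0 eqxx in kl.
- exact: gdis.
- by rewrite disjoint_sym gdis.
- exact: Adis.
Qed.

(** What a rearrangement protecting [J] and [W] must respect. Since changed slots avoid [W], it
    creates no new conflict with an edge inside [W]. *)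
Definition keeps (A A' : {ffun I * bool -> {set V}})
    (J : {set I}) (W : {set V}) : Prop :=
  [/\ forall k, k.1 \in J -> A' k = A k,
      forall k, (A' k == set0) = (A k == set0) &
      forall k, A' k = A k \/ [disjoint A' k & W]].

(* If [g] is blocked, the classes of its blockers are added to [J] and [g]
   together with their current edges to [W]: this costs at most four vertices
   for each new class and one for [g], whence the constant 5.  An edge found
   for a new class then replaces a blocker of [g]. *)
Lemma free_edge (A : {ffun I * bool -> {set V}}) (J : {set I}) (W : {set V}) :
  assignment A -> J != set0 -> {in J, forall i, load A i \subset W} ->
  #|W| + 3 <= 5 * #|J| ->
  exists A' i g, [/\ assignment A', keeps A A' J W, i \in J,
    E i g /\ [disjoint g & W] & forall k, [disjoint g & A' k]].
Proof.
have [n] := ubnP #|~: J|.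
elim: n A J W => // n IHn A J W; rewrite ltnS => Jn Aok J0 AJW cW.
have [i [g [iJ Eg gW]]] := E_free J0 cW.
(* Inner induction on the number of slots that meet [g], with [g] fixed. *)
have [b] := ubnP #|[set k | ~~ [disjoint g & A k]]|.
elim: b A Aok AJW => // b IHb A Aok AJW; rewrite ltnS => cb.
pose Bl := [set k | ~~ [disjoint g & A k]].
have [Bl0|/set0Pn[k0 k0Bl]] := eqVneq Bl set0.
  exists A, i, g; split=> //; first by split=> // k; left.
  by move=> k; move/setP: Bl0 => /(_ k); rewrite !inE => /negbFE.
pose X := [set k.1 | k in Bl].
pose U := \bigcup_(j in X) load A j.
have XJ : [disjoint X & J].
  rewrite disjoint_subset; apply/subsetP=> _ /imsetP[k kBl ->]; rewrite inE.
  apply/negP=> /AJW kW; move: kBl; rewrite inE => /negP; apply.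
  by rewrite (disjointWr _ gW) // (subset_trans (sub_load A k)).
have cJ1 : #|J :|: X| = #|J| + #|X|.
  by rewrite cardsU; move: XJ; rewrite -setI_eq0 setIC => /eqP->; rewrite cards0 subn0.
have X0 : 0 < #|X| by apply/card_gt0P; exists k0.1; apply: imset_f.
have cU : #|U| <= 4 * #|X|.
  rewrite mulnC -sum_nat_const /U; elim/big_rec2: _ => [|j m S _ IH].
    by rewrite cards0.
  by rewrite (leq_trans (leq_card_setU _ _).1) // leq_add // card_load.
(* Of the at most two vertices of [g], one lies on the blocker [k0]. *)
have cg : #|g :\: U| <= 1.
  have /andP[_ g2] := E_card Eg.
  suff : 0 < #|g :&: U| by move: (cardsID U g); lia.
  move: (k0Bl); rewrite inE -setI_eq0 => /set0Pn[v]; rewrite inE => /andP[vg vA].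
  apply/card_gt0P; exists v; rewrite inE vg; apply/bigcupP; exists k0.1.
    exact: imset_f.
  exact: (subsetP (sub_load A k0)).
pose W1 := W :|: (g :|: U).
have cW1 : #|W1| + 3 <= 5 * #|J :|: X|.
  have h0 := (leq_card_setU W (g :|: U)).1.
  have h1 : #|g :|: U| = #|U| + #|g :\: U|.
    by rewrite -(cardsID U (g :|: U)) setIC setKU setDUl setDv setU0.
  by rewrite cJ1 -/W1; move: h0; rewrite -/W1; lia.
have WW1 : W \subset W1 by rewrite subsetUl.
have gW1 : g \subset W1 by rewrite /W1 setUCA subsetUl.
have [] := IHn A (J :|: X) W1 => //.
- apply: leq_trans Jn; apply: proper_card; rewrite properE setCS subsetUl /=.
  rewrite setCS; apply/subsetPn; exists k0.1; first by rewrite inE imset_f ?orbT.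
  by rewrite (disjointFr XJ) // imset_f.
- by have /set0Pn[j jJ] := J0; apply/set0Pn; exists j; rewrite inE jJ.
- move=> j /setUP[/AJW/subset_trans|jX]; first exact.
  by apply: subset_trans (_ : U \subset _); rewrite ?bigcup_sup // /W1 setUA subsetUr.
move=> A1 [i1 [g1 [A1ok [A1J A10 A1W] i1J1 [Eg1 g1W1] g1A1]]].
have A1W' k : A1 k = A k \/ [disjoint A1 k & W].
  by case: (A1W k); [left | right; apply: disjointWr WW1 _].
have g1W : [disjoint g1 & W] by apply: disjointWr WW1 _.
case/setUP: i1J1 => [i1J|/imsetP[k1 k1Bl i1k1]].
  exists A1, i1, g1; split=> //; split=> // k kJ.
  by apply: A1J; rewrite inE kJ.
have k1J : k1.1 \notin J by rewrite (disjointFr XJ) // imset_f.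
have A10k1 : A k1 != set0.
  by apply: contraTneq k1Bl => A0; rewrite inE A0 disjoint_sym disjoints_subset sub0set.
pose A2 := reassign A1 k1 g1.
have A2ok : assignment A2 by apply: assignment_reassign => //; rewrite -i1k1.
have A2J k : k.1 \in J -> A2 k = A k.
  move=> kJ; rewrite ffunE; case: (k =P k1) => [kk1|_].
    by rewrite -kk1 kJ in k1J.
  by apply: A1J; rewrite inE kJ.
have A20 k : (A2 k == set0) = (A k == set0).
  rewrite ffunE; case: (k =P k1) => [->|_]; last exact: A10.
  rewrite (negPf A10k1); apply/negbTE; rewrite -card_gt0.
  by have /andP[] := E_card Eg1.
have A2W k : A2 k = A k \/ [disjoint A2 k & W].
  by rewrite ffunE; case: (k =P k1) => _; [right|].
have [] := IHb A2 A2ok.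
- move=> j jJ; rewrite /load !A2J //; exact: AJW.
- apply: leq_trans cb; apply: proper_card; apply/properP; split.
    apply/subsetP=> k; rewrite !inE ffunE; case: (k =P k1) => [->|_].
      by rewrite disjoint_sym (disjointWr gW1).
    by case: (A1W k) => [->//|h]; rewrite disjoint_sym (disjointWr gW1).
  by exists k1 => //; rewrite inE ffunE eqxx disjoint_sym (disjointWr gW1).
move=> A3 [i3 [g3 [A3ok [A3J A30 A3W] i3J Eg3 g3A3]]].
exists A3, i3, g3; split=> //; split=> k.
- by move=> kJ; rewrite A3J ?A2J.
- by rewrite A30 A20.
- by case: (A3W k) => [->|]; [exact: A2W | right].
Qed.

(** Empty slots are filled one at a time: [free_edge] for a single class [f0] yields an edge for its
    empty slot and keeps the set of empty slots unchanged. *)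
Lemma double_representatives :
  exists A : I * bool -> {set V},
    (forall k, E k.1 (A k)) /\ (forall k l, k != l -> [disjoint A k & A l]).
Proof.
suff [A [AE Adis] A0] : exists2 A : {ffun I * bool -> {set V}},
    assignment A & forall k, A k != set0.
  by exists A; split=> // k; apply: AE.
have : assignment [ffun => set0].
  split=> [k|k l _]; rewrite !ffunE ?eqxx //.
  by rewrite disjoints_subset sub0set.
move: [ffun => set0] => A; have [n] := ubnP #|[set k | A k == set0]|.
elim: n A => // n IHn A; rewrite ltnS => cA Aok.
have [/forallP A0|] := boolP [forall k, A k != set0]; first by exists A.
rewrite negb_forall => /existsP[[f0 b0]]; rewrite negbK => A0.
have [] := @free_edge A [set f0] (load A f0) Aok.
- by apply/set0Pn; exists f0; rewrite inE.
- by move=> j /set1P->.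
(* One slot of [f0] is empty, so its load has at most two vertices. *)
- rewrite cards1 muln1 (_ : 5 = 2 + 3) // leq_add2r /load.
  case: (b0) A0 => /eqP->; rewrite ?set0U ?setU0; exact: card_slot.
move=> A' [i [g [A'ok [_ A'0 _] /set1P-> [Eg _] gA']]].
apply: IHn (reassign A' (f0, b0) g) _ _; last exact: assignment_reassign.
have g0 : g != set0 by rewrite -card_gt0; have /andP[] := E_card Eg.
apply: leq_trans cA; apply: proper_card; apply/properP; split.
  apply/subsetP=> k; rewrite !inE ffunE.
  case: (k =P (f0, b0)) => [->|_]; last by rewrite A'0.
  by rewrite (negPf g0).
by exists (f0, b0); rewrite inE // ffunE eqxx.
Qed.

End DoubleRepresentatives.

(** * Threading a Hamilton path through linkages *)

Lemma sorted_cat_cons_split (T : Type) (r : rel T) (s1 : seq T) (x : T) (s2 : seq T) :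
  sorted r (s1 ++ x :: s2) = sorted r (rcons s1 x) && path r x s2.
Proof. by case: s1 => //= y s1; rewrite -cat_rcons cat_path last_rcons. Qed.

Section Routing.

Variables (T : finType) (e : rel T) (B : T -> {set T}) (M : {set T}) (s : T).
Variables (m : T -> T) (rk : T -> nat) (Lk : T * bool -> {set T}) (u0 v0 : T).

Definition key (q : T) : bool := (q \in M) && (q != s).

Hypothesis e_sym : symmetric e.
Hypothesis sM : s \in M.
Hypothesis mM : forall q, key q -> m q \in M.
Hypothesis rk_m : forall q, key q -> rk q < rk (m q).
Hypothesis B_clique : forall x, x \in M -> clique e (B x).
Hypothesis B_hit : forall v, exists2 x, x \in M & v \in B x.
Hypothesis Lk_spec : forall q b, key q -> exists v w,
  [/\ Lk (q, b) = [set v; w], v \in B q, w \in B (m q) & v = w \/ e v w].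
Hypothesis Lk_disj : forall k l, key k.1 -> key l.1 -> k != l ->
  [disjoint Lk k & Lk l].
Hypothesis Lk_ends : forall k, key k.1 -> (u0 \notin Lk k) && (v0 \notin Lk k).
Hypothesis uv : u0 != v0.

Definition adjM : rel T :=
  [rel x y | key x && (m x == y) || key y && (m y == x)].

Lemma adjM_bridge x y : adjM x y -> exists q, [/\ key q,
  q = x /\ m q = y \/ q = y /\ m q = x &
  forall b, exists w v, [/\ w \in Lk (q, b), v \in Lk (q, b), w \in B x,
    v \in B y & w = v \/ e w v]].
Proof.
case/orP=> /andP[kq /eqP mq]; [exists x | exists y]; split; auto.
  move=> b; have [v [w [-> vB wB vw]]] := Lk_spec b kq.
  by exists v, w; rewrite !inE !eqxx orbT -mq.
move=> b; have [v [w [-> vB wB vw]]] := Lk_spec b kq.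
exists w, v; rewrite !inE !eqxx orbT -mq; split=> //.
by case: vw => [->|]; [left | rewrite e_sym; right].
Qed.

(* A pair [(a, Some x)] in a walk records that the edge leaving [a] lies in the
   bag [B x], so that further vertices of [B x] can be inserted there. *)
Definition step : rel (T * option T) := [rel a b | e a.1 b.1 &&
  (if a.2 is Some x then (a.1 \in B x) && (b.1 \in B x) else true)].

(** The last label is [None] because no edge leaves [v0]. The condition on [last] excludes the empty
    sequence, as [u0 != v0]. *)
Definition walk (P : seq (T * option T)) : Prop :=
  [/\ sorted step P, (head (u0, None) P).1 = u0,
      last (u0, None) P = (v0, None) & uniq (unzip1 P)].

Lemma step_in_bag x a b l : x \in M -> a \in B x -> b \in B x -> a != b ->
  step (a, Some x) (b, l).
Proof.
by move=> xM aB bB ab; apply/andP; split; [apply: (B_clique xM) | apply/andP].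
Qed.

(** The new stretch goes between the ends of an edge labelled [x], which are adjacent to its own
    ends because the bag is a clique. The label [x] survives on the edge entering the stretch, so
    the bag can be used again. *)
Lemma walk_insert P x q0 Q :
  x \in M -> walk P -> Some x \in unzip2 P -> path step q0 Q ->
  q0.1 \in B x -> (last q0 Q).1 \in B x -> (last q0 Q).2 = None ->
  uniq (unzip1 (P ++ q0 :: Q)) ->
  exists2 P', walk P' & perm_eq P' (P ++ q0 :: Q).
Proof.
move=> xM [sP hP lP uP] /mapP[[a l] aP /= Ex] sQ q0B; rewrite -{}Ex in aP.
case/splitPr: aP sP hP lP uP => P1 [|[b lb] P2].
  by rewrite last_cat.
rewrite sorted_cat_cons_split => /andP[sP1 /= /andP[/andP[eab /andP[aB bB]] sP2]].
move=> hP lP uP lQB lQ uPQ; rewrite /= in aB bB.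
have pe : perm_eq (P1 ++ (a, Some x) :: (q0 :: Q) ++ (b, lb) :: P2)
    ((P1 ++ [:: (a, Some x), (b, lb) & P2]) ++ q0 :: Q).
  rewrite -catA perm_cat2l /= perm_cons -cat_cons.
  by rewrite -[X in perm_eq _ X]cat_cons perm_catC.
exists (P1 ++ (a, Some x) :: (q0 :: Q) ++ (b, lb) :: P2) => //.
have uP' : uniq (unzip1 (P1 ++ (a, Some x) :: (q0 :: Q) ++ (b, lb) :: P2)).
  by rewrite (perm_uniq (perm_map _ pe)).
have fresh z : z \in unzip1 (q0 :: Q) -> z != a /\ z != b.
  move=> zQ; move: uPQ; rewrite /unzip1 map_cat cat_uniq => /and3P[_ /hasPn h _].
  have := h z zQ; rewrite map_cat mem_cat !inE !negb_or.
  by case/and4P.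
have [q0a _] := fresh q0.1 (map_f _ (mem_head _ _)).
have [_ lb'] := fresh _ (map_f _ (mem_last _ _)).
split=> //.
- have st1 : step (a, Some x) q0.
    by case: (q0) q0B q0a => c lc /= cB ca; apply: step_in_bag; rewrite // eq_sym.
  have st2 : step (last q0 Q) (b, lb).
    by rewrite /step /= lQ andbT; apply: (B_clique xM).
  by rewrite sorted_cat_cons_split sP1 cat_cons [path _ _ _]/= st1 cat_path sQ
    [path _ _ _]/= st2 sP2.
- by case: (P1) hP.
- by move: lP; rewrite !last_cat /= last_cat.
Qed.


(** Bounds the vertices of a walk serving the marks of [Vis], so that linkages to other marks remain
    free. *)
Definition used (Vis : {set T}) (z : T) : Prop :=
  [\/ z = u0, z = v0 |
      exists k, [/\ key k.1, k.1 \in Vis, m k.1 \in Vis & z \in Lk k]].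

Definition state (Vis : {set T}) (P : seq (T * option T)) : Prop :=
  [/\ walk P, forall x, x \in Vis -> Some x \in unzip2 P &
      forall z, z \in unzip1 P -> used Vis z].

Lemma fresh_link (Vis : {set T}) x y q k z : y \notin Vis -> key q ->
  q = x /\ m q = y \/ q = y /\ m q = x -> k.1 = q -> z \in Lk k -> ~ used Vis z.
Proof.
move=> yV kq qxy kk zk; have kk1 : key k.1 by rewrite kk.
have /andP[u0k v0k] := Lk_ends kk1.
case=> [zu|zv|[l [kl lV mlV zl]]].
- by rewrite -zu zk in u0k.
- by rewrite -zv zk in v0k.
have [kl'|kl'] := eqVneq k l.
  rewrite -kl' kk in lV mlV.
  case: qxy => -[q1 q2]; first by rewrite q2 (negPf yV) in mlV.
  by rewrite q1 (negPf yV) in lV.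
by rewrite (disjointFr (Lk_disj kk1 kl kl') zk) in zl.
Qed.

Lemma state_attach (Vis : {set T}) P x y :
  x \in M -> y \in M -> x \in Vis -> y \notin Vis -> adjM x y -> state Vis P ->
  exists P', state (y |: Vis) P'.
Proof.
move=> xM yM xV yV /adjM_bridge[q [kq qxy br]] [wP lP vP].
have [w [v [wL vL wB vB wv]]] := br true.
have [w' [v' [wL' vL' wB' vB' wv']]] := br false.
have fr b z : z \in Lk (q, b) -> z \notin unzip1 P.
  by move=> zk; apply/negP=> /vP; apply: (fresh_link yV kq qxy _ zk).
have ne z z' : z \in Lk (q, true) -> z' \in Lk (q, false) -> z != z'.
  move=> zL zL'; apply: contraTneq zL' => <-.
  have kn : (q, true) != (q, false) by rewrite xpair_eqE andbF.
  by rewrite (disjointFr (@Lk_disj (q, true) (q, false) kq kq kn) zL).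
(* A linkage may be a single vertex, which is then listed only once. *)
pose Q := (if w == v then [::] else [:: (w, None)]) ++ (v, Some y) :: (v', None) ::
   (if w' == v' then [::] else [:: (w', None : option T)]).
have Qlink z : z \in unzip1 Q -> exists b, z \in Lk (q, b).
  rewrite /Q; do 2 case: eqP => _; rewrite !inE;
  repeat (case/orP); move/eqP=> ->; by [exists true | exists false].
have : exists2 P', walk P' & perm_eq P' (P ++ Q).
  have uPQ : uniq (unzip1 (P ++ Q)).
    rewrite /unzip1 map_cat cat_uniq; case: wP => _ _ _ -> /=; apply/andP; split.
      by apply/hasPn=> z /Qlink[b]; apply: fr.
    have vv' := ne _ _ vL vL'; have vw' := ne _ _ vL wL'.
    have wv'' := ne _ _ wL vL'; have ww' := ne _ _ wL wL'.
    rewrite /Q; case: eqP => [_|/eqP wv1]; case: eqP => [_|/eqP wv2];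
      by rewrite /= ?inE ?negb_or ?vv' ?vw' ?wv'' ?ww' ?wv1 ?[v' == w']eq_sym ?wv2.
  have st : step (v, Some y) (v', None) by apply: step_in_bag => //; apply: ne.
  have stw : w != v -> step (w, None) (v, Some y).
    by case: wv => [->|ewv]; rewrite ?eqxx // /step /= ewv.
  have stw' : w' != v' -> step (v', None) (w', None).
    by case: wv' => [->|ewv]; rewrite ?eqxx // /step /= e_sym ewv.
  have lx := lP x xV.
  move: uPQ; rewrite /Q; case: eqP => [wv1|/eqP/stw {}stw];
    case: eqP => [wv2|/eqP/stw' {}stw'] uPQ;
    apply: (walk_insert xM wP lx) uPQ => //=; rewrite ?st ?stw ?stw' //.
  - by rewrite -wv1.
  - by rewrite -wv2.
  - by rewrite -wv1.
  - by rewrite -wv2.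
case=> P' wP' pe; exists P'; split=> //.
- move=> z /setU1P[->|/lP zP]; rewrite (perm_mem (perm_map snd pe)) map_cat mem_cat.
    by apply/orP; right; rewrite /Q map_cat mem_cat /= inE eqxx orbT.
  by rewrite zP.
- move=> z; rewrite (perm_mem (perm_map fst pe)) map_cat mem_cat.
  case/orP=> [/vP|/Qlink[b zb]].
    case=> [->|->|[k [kk kV mkV zk]]]; [constructor 1|constructor 2|constructor 3] => //.
    by exists k; rewrite !inE kV mkV !orbT.
  constructor 3; exists (q, b); rewrite /= kq zb !inE.
  by case: qxy => -[q1 q2]; split=> //; rewrite ?q2 ?q1 ?xV ?eqxx ?orbT.
Qed.

(** A missing vertex lies in a marked bag and is inserted at the edge with that label. *)
Lemma hamilton_of_walk P : walk P -> (forall x, x \in M -> Some x \in unzip2 P) ->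
  exists p, hamilton_path e u0 v0 p.
Proof.
have [n] := ubnP #|[set z | z \notin unzip1 P]|.
elim: n P => // n IHn P; rewrite ltnS => cP wP lP.
have [/forallP allP|] := boolP [forall z, z \in unzip1 P].
  have [sP hP lastP uP] := wP.
  case: P hP {IHn cP wP lP} sP lastP uP allP => [|[a l] P] /= hP sP lastP uP allP.
    by case: lastP => uv0; case/eqP: uv.
  rewrite hP in uP sP allP lastP *; exists (unzip1 P); split=> //.
  - rewrite -[u0]/((u0, l).1) path_map; apply: sub_path sP.
    by move=> x y /andP[].
  - by rewrite -[u0]/((u0, l).1) last_map lastP.
rewrite negb_forall => /existsP[z zP].
have [x xM zB] := B_hit z.
have [|P' wP' pe] := @walk_insert P x (z, None) [::] xM wP (lP x xM) isT zB zB erefl.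
  rewrite /unzip1 map_cat cat_uniq /=; case: wP => _ _ _ -> /=.
  by rewrite orbF zP.
have meP a : (a \in unzip1 P') = (a \in unzip1 P) || (a == z).
  by rewrite (perm_mem (perm_map fst pe)) map_cat mem_cat inE.
apply: (IHn P') => //.
  apply: leq_trans cP; apply: proper_card; apply/properP; split.
    by apply/subsetP=> a; rewrite !inE meP => /norP[].
  by exists z; rewrite inE // meP eqxx orbT.
by move=> y yM; rewrite (perm_mem (perm_map snd pe)) map_cat mem_cat lP.
Qed.

(** Some tree edge leaves [Vis]: the one above the highest mark outside [Vis] if the root is in
    [Vis], and the one above the highest mark of [Vis] otherwise. The mark at its far end is
    attached. *)
Lemma hamilton_of_state (Vis : {set T}) P :
  Vis \subset M -> Vis != set0 -> state Vis P ->
  exists p, hamilton_path e u0 v0 p.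
Proof.
have [n] := ubnP #|M :\: Vis|.
elim: n Vis P => // n IHn Vis P; rewrite ltnS => cV VM V0 stP.
have [MV|/subsetPn[y0 y0M y0V]] := boolP (M \subset Vis).
  case: stP => wP lP _; apply: hamilton_of_walk wP _ => x /(subsetP MV); exact: lP.
have [x [y [xV yM yV xy]]] : exists x y,
    [/\ x \in Vis, y \in M, y \notin Vis & adjM x y].
  have [sV|sV] := boolP (s \in Vis).
    have y0P : (y0 \in M) && (y0 \notin Vis) by rewrite y0M.
    pose unvisited y := (y \in M) && (y \notin Vis).
    case: (@arg_maxnP T y0 unvisited rk y0P) => y /andP[yM yV] ymax.
    have ky : key y by rewrite /key yM; apply: contraNneq yV => ->.
    exists (m y), y; split=> //; last by rewrite /adjM /= ky eqxx orbT.
    apply: contraT => myV; have := ymax (m y); rewrite /unvisited mM // myV => /(_ isT).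
    by have := rk_m ky; lia.
  have /set0Pn[x0 x0V] := V0; case: (@arg_maxnP T x0 (mem Vis) rk x0V) => x xV xmax.
  have kx : key x.
    by rewrite /key (subsetP VM) //; apply: contraNneq sV => <-.
  exists x, (m x); split=> //; last by rewrite /adjM /= kx eqxx.
    exact: mM.
  by apply/negP=> /xmax; have := rk_m kx; lia.
have [P' stP'] := state_attach (subsetP VM x xV) yM xV yV xy stP.
apply: IHn stP'.
- apply: leq_trans cV; apply: proper_card; apply/properP; split.
    by apply: setDS; apply: subsetUr.
  by exists y; rewrite !inE ?yV ?yM // eqxx.
- by rewrite subUset sub1set yM.
- by apply/set0Pn; exists y; rewrite !inE eqxx.
Qed.

Lemma adjM_connect x y : x \in M -> y \in M -> connect adjM x y.
Proof.
have symM : connect_sym adjM.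
  by apply: sym_connect_sym => a b; rewrite /adjM /= orbC.
suff cs z : z \in M -> connect adjM z s.
  by move=> xM yM; apply: (connect_trans (cs x xM)); rewrite symM cs.
have [n] := ubnP (\max_(i : T) rk i - rk z).
elim: n z => // n IHn z; rewrite ltnS => cz zM.
have [->|zs] := eqVneq z s; first exact: connect0.
have kz : key z by rewrite /key zM.
apply: (@connect_trans _ _ (m z)); first by apply: connect1; rewrite /adjM /= kz eqxx.
apply: IHn; last exact: mM.
by have := rk_m kz; have := @leq_bigmax _ rk (m z); lia.
Qed.

(** The tree path [x :: c] is followed over one linkage for each of its edges. The last label of [P]
    announces an edge inside the bag of [last x c], which the vertex appended next has to
    provide. *)
Lemma trail x c : x \in M -> u0 \in B x -> all (mem M) c -> path adjM x c ->
  uniq (x :: c) ->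
  exists P a l, P = rcons a (l, Some (last x c)) /\
   [/\ sorted step P, (head (u0, None) P).1 = u0, l \in B (last x c) &
    [/\ uniq (unzip1 P), forall z, z \in x :: c -> Some z \in unzip2 P &
      forall z, z \in unzip1 P -> z = u0 \/
        exists k, [/\ key k.1, k.1 \in x :: c, m k.1 \in x :: c & z \in Lk k]]].
Proof.
move=> xM u0B; elim/last_ind: c => [|c y IHc].
  move=> _ _ _; exists [:: (u0, Some x)], [::], u0; split=> //; split=> //.
  by split=> // z; rewrite inE => /eqP->; rewrite ?inE //; left.
rewrite all_rcons => /andP[/= yM cM]; rewrite rcons_path => /andP[pc ad].
rewrite last_rcons => uxc.
have /andP[yc uc] : (y \notin x :: c) && uniq (x :: c) by rewrite -rcons_uniq.
have [_ [P [a [-> [sP hP aB [uP lP vP]]]]]] := IHc cM pc uc.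
have curM : last x c \in M.
  by have := mem_last x c; rewrite inE => /predU1P[->//|/(allP cM)].
have [q [kq qxy br]] := adjM_bridge ad.
have [w [v [wL vL wB vB wv]]] := br true.
have yV : y \notin [set z in x :: c] by rewrite inE.
have fr z : z \in Lk (q, true) -> z \notin unzip1 (rcons P (a, Some (last x c))).
  move=> zk; apply/negP=> /vP zused; apply: (fresh_link yV kq qxy _ zk) => //.
  case: zused => [->|[k [kk k1 k2 zk']]]; first by constructor 1.
  by constructor 3; exists k; rewrite !inE.
pose Q := (if w == v then [::] else [:: (w, None : option T)]).
have Qlink z : z \in unzip1 (rcons Q (v, Some y)) -> z \in Lk (q, true).
  by rewrite /Q; case: eqP => _; rewrite !inE; [move/eqP-> | case/orP=> /eqP->].
exists (rcons P (a, Some (last x c)) ++ rcons Q (v, Some y)),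
       (rcons P (a, Some (last x c)) ++ Q), v.
have aw : a != w.
  have := fr w wL; rewrite /unzip1 map_rcons mem_rcons inE negb_or eq_sym.
  by case/andP.
split; first by rewrite rcons_cat.
split=> //.
- have stl l : step (a, Some (last x c)) (w, l) by apply: step_in_bag.
  rewrite cat_rcons sorted_cat_cons_split sP /Q.
  case: eqP => [<-|/eqP wv1]; rewrite [path _ _ _]/= stl // /step /= !andbT.
  by case: wv => // wv; rewrite wv eqxx in wv1.
- by move: hP; case: (P).
split.
- rewrite /unzip1 map_cat cat_uniq uP /=; apply/andP; split.
    by apply/hasPn=> z /Qlink; apply: fr.
  by rewrite /Q; case: eqP => //= /eqP; rewrite inE => ->.
- move=> z; rewrite -rcons_cons mem_rcons inE /unzip2 map_cat mem_cat.
  case/predU1P=> [->|/lP->//]; apply/orP; right.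
  by rewrite map_rcons mem_rcons inE eqxx.
- move=> z; rewrite /unzip1 map_cat mem_cat => /orP[/vP[->|[k [kk k1 k2 zk]]]|/Qlink zk].
  + by left.
  + by right; exists k; rewrite -rcons_cons !mem_rcons !(in_cons y) k1 k2 !orbT.
  + right; exists (q, true); split=> //=; rewrite -rcons_cons mem_rcons in_cons;
    case: qxy => -[q1 q2]; rewrite ?q2 ?q1 ?eqxx ?mem_last ?orbT //.
Qed.

(** The trail from a bag containing [u0] to one containing [v0], completed by [v0], is a first
    state; the other marks are attached to it. *)
Theorem hamilton_of_linkages : exists p, hamilton_path e u0 v0 p.
Proof.
have [x xM u0B] := B_hit u0; have [y yM v0B] := B_hit v0.
have /connectP[c0 pc0 lc0] := adjM_connect xM yM.
move: lc0; case/shortenP: pc0 => c pc uc _ yc.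
have cM : all (mem M) c.
  apply/allP=> z zc; case/splitPr: zc pc => c1 c2; rewrite cat_path /=.
  case/and3P=> _ /orP[]/andP[kz mz] _; last by case/andP: kz.
  by rewrite -(eqP mz) mM.
have [P [a [l [-> [sP hP lB [uP lP vP]]]]]] := trail xM u0B cM pc uc.
have v0P : v0 \notin unzip1 (rcons a (l, Some (last x c))).
  apply/negP=> /vP[v0u|[k [kk _ _ zk]]]; first by case/eqP: uv.
  by have /andP[_ /negP] := Lk_ends kk.
apply: (@hamilton_of_state [set z in x :: c]
   (rcons (rcons a (l, Some (last x c))) (v0, None))).
- apply/subsetP=> z; rewrite !inE => /predU1P[->//|]; exact: (allP cM).
- by apply/set0Pn; exists x; rewrite !inE eqxx.
split.
- split.
  + rewrite -cats1 cat_rcons sorted_cat_cons_split sP [path _ _ _]/= andbT.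
    apply: step_in_bag => //; rewrite -?yc //.
    apply: contraNneq v0P => <-.
    by rewrite /unzip1 map_rcons mem_rcons inE eqxx.
  + by move: hP; case: (a).
  + by rewrite last_rcons.
  + by rewrite /unzip1 map_rcons rcons_uniq v0P.
- move=> z; rewrite inE => /lP zl.
  by rewrite /unzip2 map_rcons mem_rcons inE zl orbT.
- move=> z; rewrite /unzip1 map_rcons mem_rcons inE => /predU1P[->|/vP].
    by constructor 2.
  case=> [->|[k [kk k1 k2 zk]]]; first by constructor 1.
  by constructor 3; exists k; rewrite !inE -!in_cons.
Qed.

End Routing.

(** * The tree of an elimination order *)

Section EliminationTree.

Variables (T : finType) (e : rel T) (K : {set T}) (s : T) (rk : T -> nat) (n : nat).

(** For [x] outside [K], the separator of the tree edge above [x]. *)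
Definition later (x : T) : {set T} := [set y | e x y & rk x < rk y].

Hypotheses (e_sym : symmetric e) (e_irr : irreflexive e).
Hypotheses (sK : s \in K) (cK : clique e K) (sN : forall x, e s x -> x \in K).
Hypothesis rk_le : forall x, rk x <= n.
Hypothesis rk_lt : forall x, (rk x < n) = (x \notin K).
Hypothesis rk_inj : {in ~: K &, injective rk}.
Hypothesis later_clique : forall x, x \notin K -> clique e (later x).

(* The nodes of the tree are the vertices outside [K] together with the root
   [s], whose bag is the whole clique [K]. *)
Definition node (x : T) : bool := (x \notin K) || (x == s).

(** The highest node whose bag contains [v]. *)
Definition top_node (v : T) : T := if v \in K then s else v.

Definition bag (x : T) : {set T} := if x \in K then K else x |: later x.

(** The lowest vertex of [later x], with [K] contracted to [s]. A node with empty [later x] hangs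
    below the root, which is its own parent. *)
Definition parent (x : T) : T :=
  if x \in K then s
  else if [pick y in later x | [forall z in later x, rk y <= rk z]] is Some y
       then top_node y else s.

(** [anc x y] means that [y] is [x] or lies above it. *)
Definition anc : rel T := fconnect parent.

Definition children (x : T) : {set T} := [set c | (c \notin K) && (parent c == x)].

Lemma rk_K x : x \in K -> rk x = n.
Proof. by move=> xK; have := rk_le x; have := rk_lt x; rewrite xK; clear; lia. Qed.

Lemma rk_top_node v : rk (top_node v) = rk v.
Proof. by rewrite /top_node; case: ifP => // vK; rewrite !rk_K. Qed.

Lemma node_top_node v : node (top_node v).
Proof. by rewrite /top_node /node; case: ifP => [_|->]; rewrite ?eqxx ?orbT. Qed.

Lemma node_K x : node x -> x \in K -> x = s.
Proof. by case/orP=> [/negPf->|/eqP]. Qed.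

Lemma node_parent x : node (parent x).
Proof.
rewrite /parent; case: ifP => _; first by rewrite /node eqxx orbT.
by case: pickP => [y _|_]; rewrite ?node_top_node // /node eqxx orbT.
Qed.

Lemma parent_K x : x \in K -> parent x = s.
Proof. by rewrite /parent => ->. Qed.

Lemma rk_parent x : x \notin K -> rk x < rk (parent x).
Proof.
move=> xK; rewrite /parent (negPf xK); case: pickP => [y|_].
  by rewrite inE => /andP[/andP[_ xy] _]; rewrite rk_top_node.
by rewrite (rk_K sK) rk_lt.
Qed.

Lemma mem_bag_top v : v \in bag (top_node v).
Proof.
rewrite /bag /top_node; case: (boolP (v \in K)) => vK; first by rewrite sK.
by rewrite (negPf vK) setU11.
Qed.

Lemma later_bag x v : x \notin K -> v \in later x -> v \in bag x.
Proof. by move=> xK vx; rewrite /bag (negPf xK) inE vx orbT. Qed.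

(** Since [later x] is a clique, its lowest vertex is adjacent to all its other vertices. *)
Lemma later_bag_parent x v : x \notin K -> v \in later x -> v \in bag (parent x).
Proof.
move=> xK vx; rewrite /parent (negPf xK); case: pickP => [y|/= no_min]; last first.
  case: (@arg_minnP T v (mem (later x)) rk vx) => y /= yx ymin.
  by have := no_min y; rewrite yx /= => /forall_inP[].
move=> /andP[yx /forall_inP/(_ v vx) yv].
have [<-|neq] := eqVneq y v; first exact: mem_bag_top.
have eyv : e y v by apply: (later_clique xK).
rewrite /top_node; case: ifP => yK.
  rewrite /bag sK; apply: contraT => vK.
  by have := rk_lt v; rewrite vK; have := rk_K yK; move: yv; clear; lia.
rewrite /bag yK !inE eyv /=; apply/orP; right.
rewrite ltn_neqAle yv andbT; apply: contra_neq neq => rkyv.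
apply: rk_inj => //; rewrite !inE ?yK //.
by have := rk_lt y; have := rk_lt v; rewrite yK rkyv => ->.
Qed.

Lemma bag_clique x : clique e (bag x).
Proof.
rewrite /bag; case: ifP => // xK y z /setU1P[->|yx] /setU1P[->|zx] neq.
- by rewrite eqxx in neq.
- by move: zx; rewrite inE => /andP[].
- by move: yx; rewrite inE e_sym => /andP[].
- by apply: (later_clique (negbT xK)).
Qed.

Lemma anc_refl x : anc x x.
Proof. exact: connect0. Qed.

Lemma anc_trans y x z : anc x y -> anc y z -> anc x z.
Proof. exact: connect_trans. Qed.

Lemma anc_parent x : anc x (parent x).
Proof. exact: fconnect1. Qed.

Lemma anc_first x z : anc x z -> x = z \/ anc (parent x) z.
Proof.
case/connectP=> [[|y p]] /=; first by left.
by case/andP=> /eqP-> px ->; right; apply/connectP; exists p.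
Qed.

Lemma anc_last x z : anc x z -> x = z \/ exists2 c, parent c = z & anc x c.
Proof.
case/connectP=> p; case/lastP: p => [|p y]; first by left.
rewrite rcons_path last_rcons => /andP[px /eqP pc] ->; right.
by exists (last x p) => //; apply/connectP; exists p.
Qed.

Lemma leq_rk_parent x : rk x <= rk (parent x).
Proof.
case: (boolP (x \in K)) => [xK|/rk_parent/ltnW//].
by rewrite parent_K // !rk_K.
Qed.

Lemma anc_rk x z : anc x z -> rk x <= rk z.
Proof.
case/connectP=> p; elim: p x => [|y p IH] x /=; first by move=> _ ->.
by case/andP=> /eqP<- px /(IH _ px); apply: leq_trans (leq_rk_parent x).
Qed.

Lemma anc_notK x z : anc x z -> z \notin K -> x \notin K.
Proof. by move=> /anc_rk; rewrite -!rk_lt; clear; lia. Qed.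

Lemma anc_root z : anc s z -> z = s.
Proof.
case/connectP=> p; elim: p => [|y p IH] //=.
by rewrite parent_K // => /andP[/eqP<-].
Qed.

Lemma anc_total x y z : anc x y -> anc x z -> anc y z \/ anc z y.
Proof.
case/connectP=> p; elim: p x => [|x' p IH] x /=; first by move=> _ ->; left.
case/andP=> /eqP xx' px ly /anc_first[<-|]; last by rewrite xx'; apply: IH.
by right; apply: anc_trans (anc_parent x) _; rewrite xx'; apply/connectP; exists p.
Qed.

Lemma anc_rk_eq x y : x \notin K -> anc x y -> rk y <= rk x -> x = y.
Proof.
move=> xK /anc_first[//|/anc_rk]; have := rk_parent xK; clear; lia.
Qed.

Lemma anc_antisym x y : node x -> anc x y -> anc y x -> x = y.
Proof.
move=> nx xy yx; case: (boolP (x \in K)) => [/(node_K nx) xs|xK].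
  by rewrite xs in xy *; rewrite (anc_root xy).
exact: (anc_rk_eq xK xy (anc_rk yx)).
Qed.

Lemma bag_later x v : node x -> v \in bag x -> x != top_node v ->
  x \notin K /\ v \in later x.
Proof.
move=> nx; rewrite /bag /top_node; case: (boolP (x \in K)) => [xK vK|xK].
  by rewrite vK (node_K nx xK) eqxx.
case/setU1P=> [->|//]; by rewrite (negPf xK) eqxx.
Qed.

(** Below its top node, a vertex of the bag of [x] lies in [later x] and so passes on to the bag of
    the parent. *)
Lemma bag_anc_top x v : node x -> v \in bag x -> anc x (top_node v).
Proof.
have [k] := ubnP (n - rk x); elim: k x => // k IH x; rewrite ltnS => kx nx vx.
have [->|xt] := eqVneq x (top_node v); first exact: anc_refl.
have [xK vl] := bag_later nx vx xt; apply: anc_trans (anc_parent x) _.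
apply: IH; [|exact: node_parent|exact: later_bag_parent].
by have := rk_parent xK; have := rk_le (parent x); move: kx; clear; lia.
Qed.

(** Together with [bag_anc_top]: the nodes whose bags contain [v] form a subtree with top
    [top_node v]. *)
Lemma bag_between x z v :
  node x -> v \in bag x -> anc x z -> anc z (top_node v) -> v \in bag z.
Proof.
move=> nx vx /connectP[p]; elim: p x nx vx => [|y p IH] x nx vx /=.
  by move=> _ ->.
case/andP=> /eqP xy py lz zt.
have [xt|xt] := eqVneq x (top_node v).
  have xz : anc x z.
    by apply: anc_trans (anc_parent x) _; rewrite xy; apply/connectP; exists p.
  by rewrite -(anc_antisym nx xz) // xt.
have [xK vl] := bag_later nx vx xt.
apply: (IH y) => //; first by rewrite -xy node_parent.
by rewrite -xy later_bag_parent.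
Qed.

Lemma adj_later x y : e x y -> rk x < rk y -> x \notin K /\ y \in later x.
Proof.
move=> exy xy; rewrite inE exy xy; split=> //.
by rewrite -rk_lt; have := rk_le y; move: xy; clear; lia.
Qed.

Definition marking (M : {set T}) : bool :=
  [&& [forall x in M, node x], s \in M,
      [forall x, (x \notin K) && (#|children x| != 1) ==> (x \in M)] &
      [forall v, exists x in M, v \in bag x]].

(* A marking of least total rank: moving an optional mark [x] down to the only
   child of [x] must uncover some vertex, which then has no mark but [x]. *)
Lemma marking_exists : exists2 M, marking M &
  forall x, x \in M -> x \notin K -> #|children x| = 1 ->
  exists v c, [/\ c \in children x, v \in bag x, v \notin bag c &
    forall z, z \in M -> v \in bag z -> z = x].
Proof.
have mark0 : marking [set x | node x].
  apply/and4P; split.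
  - by apply/forall_inP=> x; rewrite inE.
  - by rewrite inE /node eqxx orbT.
  - by apply/forallP=> x; apply/implyP=> /andP[xK _]; rewrite inE /node xK.
  - apply/forallP=> v; apply/exists_inP; exists (top_node v).
      by rewrite inE node_top_node.
    exact: mem_bag_top.
pose weight (M : {set T}) := \sum_(x in M) (rk x).+1.
case: (@arg_minnP _ _ marking weight mark0) => M markM minM; exists M => //.
move=> x xM xK /eqP/cards1P[c chx].
have cx : c \in children x by rewrite chx inE.
have [cNK pc] : c \notin K /\ parent c = x by move: cx; rewrite inE => /andP[? /eqP].
have rcx : rk c < rk x by rewrite -pc rk_parent.
(* Either [c] is marked already and only the mark [x] goes, or [x] is exchanged for [c], of smaller
   rank. *)
have ltw : weight (c |: (M :\ x)) < weight M.
  rewrite /weight (big_setD1 x xM) /=.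
  have [cM|cM] := boolP (c \in M :\ x).
    by rewrite (setUidPr _) ?sub1set //; clear; lia.
  by rewrite big_setU1 //=; move: rcx; clear; lia.
have nomark : ~~ marking (c |: (M :\ x)).
  by apply/negP=> /minM; rewrite leqNgt ltw.
case/and4P: markM => /forall_inP Mnode sM /forallP Mun /forallP Mhit.
have xs : x != s by apply: contraNneq xK => ->.
(* Only the covering clause can fail. *)
move: nomark; rewrite /marking; case/nandP.
  case/forall_inP=> z /setU1P[->|/setD1P[_ /Mnode//]]; by rewrite /node cNK.
case/nandP; first by rewrite !inE sM [s == x]eq_sym xs orbT.
case/nandP.
  case/forallP=> z; apply/implyP=> zP; have := Mun z; rewrite zP /= => zM.
  rewrite !inE zM andbT; case: (eqVneq z x) => [zx|]; last by rewrite orbT.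
  by case/andP: zP; rewrite zx chx cards1.
rewrite negb_forall => /existsP[v]; rewrite negb_exists_in => /forall_inP vno.
have /exists_inP[z0 z0M vz0] := Mhit v.
have only z : z \in M -> v \in bag z -> z = x.
  move=> zM vz; apply: contraTeq vz => zx; apply: vno.
  by rewrite !inE zx zM orbT.
exists v, c; split=> //; first by rewrite -(only z0).
by apply: vno; rewrite setU11.
Qed.

(** * Segments of the tree between consecutive marks *)

Section Segments.

Variable M : {set T}.
Hypothesis M_marking : marking M.
Hypothesis M_private : forall x, x \in M -> x \notin K -> #|children x| = 1 ->
  exists v c, [/\ c \in children x, v \in bag x, v \notin bag c &
    forall z, z \in M -> v \in bag z -> z = x].

Lemma M_node x : x \in M -> node x.
Proof. by move=> xM; have /and4P[/forall_inP/(_ x xM)] := M_marking. Qed.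

Lemma root_M : s \in M.
Proof. by have /and4P[] := M_marking. Qed.

Lemma unmarked_unary x : x \notin K -> x \notin M -> #|children x| = 1.
Proof.
move=> xK xM; have /and4P[_ _ /forallP/(_ x)] := M_marking.
by rewrite xK (negPf xM) implybF negbK => /eqP.
Qed.

Lemma M_hit v : exists2 x, x \in M & v \in bag x.
Proof. by have /and4P[_ _ _ /forallP/(_ v)/exists_inP] := M_marking. Qed.

Lemma key_notK q : key M s q -> q \notin K.
Proof.
by case/andP=> /M_node nq qs; apply: contraNN qs => /(node_K nq)->.
Qed.

Lemma key_M q : key M s q -> q \in M.
Proof. by case/andP. Qed.

(* [y] lies on the tree path from [q] up to, but excluding, the next mark. *)
Definition seg (q y : T) : bool :=
  [&& y \notin K, anc q y & [forall z in M, anc q z && anc z y ==> (z == q)]].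

Definition seg_top (q : T) : T := odflt q [pick y | seg q y && (parent y \in M)].

Definition next_mark (q : T) : T := parent (seg_top q).

Lemma segP q y : reflect [/\ y \notin K, anc q y &
  forall z, z \in M -> anc q z -> anc z y -> z = q] (seg q y).
Proof.
apply: (iffP and3P) => [[yK qy /forall_inP h]|[yK qy h]]; split=> //.
  by move=> z zM qz zy; have := h z zM; rewrite qz zy => /eqP.
by apply/forall_inP=> z zM; apply/implyP=> /andP[qz zy]; apply/eqP/h.
Qed.

Lemma seg_refl q : key M s q -> seg q q.
Proof.
move=> kq; apply/segP; split; [exact: key_notK|exact: anc_refl|].
move=> z zM qz zq; apply/esym; apply: anc_antisym => //; exact/M_node/key_M.
Qed.

(** An unmarked parent of the highest node would extend the segment, and the root is marked. *)
Lemma seg_topP q : key M s q -> seg q (seg_top q) /\ next_mark q \in M.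
Proof.
move=> kq; rewrite /next_mark /seg_top; case: pickP => [y /andP[]//|/= no].
case: (@arg_maxnP T q (seg q) rk (seg_refl kq)) => y qy ymax.
have /segP[yK aqy h] := qy.
have := no y; rewrite qy /= => /negbT pyM.
have pyK : parent y \notin K.
  by apply: contraNN pyM => /(node_K (node_parent y))->; apply: root_M.
have /ymax : seg q (parent y).
  apply/segP; split=> //; first exact: anc_trans aqy (anc_parent y).
  move=> z zM qz zpy; have [zy|] := anc_total qz aqy; first exact: h.
  case/anc_first=> [yz|pyz]; first by apply: h; rewrite // yz anc_refl.
  have zp := anc_antisym (M_node zM) zpy pyz.
  by rewrite zp (negPf pyM) in zM.
by rewrite /geq /=; have := rk_parent yK; clear; lia.
Qed.

Lemma rk_next_mark q : key M s q -> rk q < rk (next_mark q).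
Proof.
move=> kq; have [/segP[tK qt _] _] := seg_topP kq.
exact: leq_ltn_trans (anc_rk qt) (rk_parent tK).
Qed.

Lemma seg_anc_top q y : key M s q -> seg q y -> anc y (seg_top q).
Proof.
move=> kq /segP[yK qy hy]; have [/segP[tK qt ht] mM] := seg_topP kq.
have [//|/anc_first[->|py]] := anc_total qy qt; first exact: anc_refl.
have qm : anc q (next_mark q) := anc_trans qt (anc_parent _).
by have := rk_next_mark kq; rewrite (hy _ mM qm py) ltnn.
Qed.

Lemma seg_top_uniq q y : key M s q -> seg q y -> parent y \in M -> seg_top q = y.
Proof.
move=> kq qy pyM; case/anc_first: (seg_anc_top kq qy) => // pyt.
have [/segP[tK qt ht] mM] := seg_topP kq; have /segP[yK aqy _] := qy.
have := ht _ pyM (anc_trans aqy (anc_parent _)) pyt => pyq.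
by have := anc_rk aqy; have := rk_parent yK; rewrite pyq; clear; lia.
Qed.

(** Unmarked nodes outside [K] have exactly one child, so no branch enters the segment above [q]. *)
Lemma seg_comparable q y x : key M s q -> seg q y -> anc x y -> anc x q \/ anc q x.
Proof.
move=> kq; have [k] := ubnP (rk y); elim: k y => // k IH y; rewrite ltnS => ky qy xy.
have /segP[yK aqy h] := qy.
have [->|[c pc xc]] := anc_last xy; first by right.
have [->|[d pd qd]] := anc_last aqy; first by left.
have cK' : c \notin K by apply: contraNN yK => cK'; rewrite -pc parent_K.
have dK : d \notin K by apply: contraNN yK => dK; rewrite -pd parent_K.
have yM : y \notin M.
  apply/negP=> yM; have yq := h y yM aqy (anc_refl y).
  by have := anc_rk qd; have := rk_parent dK; rewrite pd yq; clear; lia.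
have /eqP/cards1P[c0 chy] := unmarked_unary yK yM.
have cc0 : c \in children y by rewrite inE cK' pc eqxx.
have dc0 : d \in children y by rewrite inE dK pd eqxx.
rewrite chy !inE in cc0 dc0; rewrite (eqP cc0) -(eqP dc0) in xc.
apply: (IH d) => //; first by have := rk_parent dK; rewrite pd; move: ky; clear; lia.
apply/segP; split=> // z zM qz zd; apply: h => //.
by apply: anc_trans zd _; rewrite -pd anc_parent.
Qed.

Lemma seg_mark q y x : key M s q -> seg q y -> x \in M -> anc x y -> anc x q.
Proof.
move=> kq qy xM xy; case: (seg_comparable kq qy xy) => // qx.
by have /segP[_ _ h] := qy; rewrite (h x xM qx xy) anc_refl.
Qed.

Lemma next_mark_least q z : key M s q -> z \in M -> anc q z -> z != q ->
  anc (next_mark q) z.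
Proof.
move=> kq zM qz zq; have [/segP[tK qt ht] _] := seg_topP kq.
have [/anc_first[tz|//]|zt] := anc_total qt qz.
  by case/eqP: zq; apply: ht => //; rewrite tz anc_refl.
by case/eqP: zq; apply: ht.
Qed.

(* The subtree of a vertex of [later y] contains a mark, and hence one of the
   two marks at the ends of the segment of [y]; where the first kind gives way
   to the second, two such vertices outside [W] would form a linkage. *)
Lemma cut_of_hitting q (W : {set T}) : key M s q ->
  (forall v w, v \in bag q -> w \in bag (next_mark q) -> v = w \/ e v w ->
     (v \in W) || (w \in W)) ->
  exists2 y, seg q y & later y \subset W.
Proof.
move=> kq hit; have [qt mM] := seg_topP kq; set t := seg_top q in qt.
have /segP[tK aqt ht] := qt.
have [/exists_inP//|] := boolP [exists y in seg q, later y \subset W].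
rewrite negb_exists_in => /forall_inP noy.
have pick_v y : seg q y -> exists2 v, v \in later y & v \notin W.
  by move/noy/subsetPn.
pose good y := seg q y && [exists v in later y, (v \notin W) && (v \in bag q)].
have goodq : good q.
  rewrite /good seg_refl //; have [v vl vW] := pick_v q (seg_refl kq).
  by apply/exists_inP; exists v => //; rewrite vW (later_bag (key_notK kq)).
case: (@arg_maxnP T q good rk goodq) => y /andP[qy /exists_inP[v vl /andP[vW vq]]] ymax.
have /segP[yK aqy hy] := qy.
have vpy : v \in bag (parent y) by apply: later_bag_parent.
have [pyM|pyM] := boolP (parent y \in M).
  have := hit v v vq; rewrite /next_mark (seg_top_uniq kq qy pyM) (negPf vW).
  by move=> /(_ vpy (or_introl erefl)).
have qpy : seg q (parent y).
  have /anc_first[yt|pyt] := seg_anc_top kq qy.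
    by move: mM; rewrite /next_mark -yt (negPf pyM).
  apply/segP; split; first exact: anc_notK pyt tK.
    exact: anc_trans aqy (anc_parent y).
  by move=> z zM qz zpy; apply: ht => //; apply: anc_trans pyt.
have /segP[pyK aqpy hpy] := qpy.
have [v' vl' vW'] := pick_v _ qpy.
have v'py : v' \in bag (parent y) by apply: later_bag.
have v'q : v' \notin bag q.
  apply/negP=> v'q; have /ymax : good (parent y).
    by rewrite /good qpy; apply/exists_inP; exists v' => //; rewrite vW' v'q.
  by rewrite /geq /=; have := rk_parent yK; clear; lia.
(* A mark covering [v'] cannot lie at or below [q], as [bag q] would then contain [v']. So the
   subtree of [v'] reaches above [t], and [v'] lies in [later t]. *)
have v'm : v' \in bag (next_mark q).
  have [z zM v'z] := M_hit v'.
  have zt := bag_anc_top (M_node zM) v'z.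
  have pyt := bag_anc_top (node_parent y) v'py.
  have nzpy : ~ anc z (parent y).
    move=> zpy; have zq := seg_mark kq qpy zM zpy.
    move/negP: v'q; apply; apply: (bag_between (M_node zM) v'z zq).
    exact: anc_trans aqpy pyt.
  have tn : anc t (top_node v') /\ t != top_node v'.
    have notbelow : ~ anc (top_node v') t.
      move=> vt; apply: nzpy; apply: anc_trans aqpy.
      exact: seg_mark kq qt zM (anc_trans zt vt).
    have [//|tv] := anc_total (seg_anc_top kq qpy) pyt.
      by move=> tv; split=> //; apply: contra_notN notbelow => /eqP<-; apply: anc_refl.
    by case: notbelow.
  case: tn => tv tne.
  have v't : v' \in bag t.
    exact: (bag_between (node_parent y) v'py (seg_anc_top kq qpy) tv).
  have nt : node t by rewrite /node tK.
  have [_ ] := bag_later nt v't tne; exact: later_bag_parent.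
have := hit v v' vq v'm; rewrite (negPf vW) (negPf vW') => /(_ _)/negP; case=> //.
have [->|neq] := eqVneq v v'; first by left.
by right; apply: (bag_clique vpy v'py).
Qed.

(** Leaves and branching nodes are marked, so descending from [c] leads to a mark; the highest mark
    at or below [c] is the one required. *)
Lemma child_key c : c \notin K -> parent c \in M ->
  exists2 q, key M s q & seg_top q = c /\ next_mark q = parent c.
Proof.
move=> cNK pcM.
have [x xM xc] : exists2 x, x \in M & anc x c.
  case: (@arg_minnP T c (anc^~ c) rk (anc_refl c)) => x xc xmin; exists x => //.
  have xK := anc_notK xc cNK; apply: contraT => xM.
  have /eqP/cards1P[d chx] := unmarked_unary xK xM.
  have : d \in children x by rewrite chx inE.
  rewrite inE => /andP[dK /eqP pd].
  have /xmin : anc d c by apply: anc_trans xc; rewrite -pd anc_parent.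
  by have := rk_parent dK; rewrite pd; clear; lia.
have xP : (x \in M) && anc x c by rewrite xM.
case: (@arg_maxnP T x (fun x => (x \in M) && anc x c) rk xP) => q /andP[qM qc] qmax.
have qK := anc_notK qc cNK.
have kq : key M s q by rewrite /key qM; apply: contraNneq qK => ->.
exists q => //; rewrite /next_mark.
suff sqc : seg q c by rewrite (seg_top_uniq kq sqc pcM).
apply/segP; split=> // z zM qz zc; apply/esym/(anc_rk_eq qK qz).
by apply: qmax; rewrite zM.
Qed.

Definition mark_children (q : T) : {set T} :=
  [set x | key M s x && (next_mark x == q)].

Lemma card_mark_children q : q \in M -> #|children q| <= #|mark_children q|.
Proof.
move=> qM; apply: leq_trans (leq_imset_card seg_top (mem (mark_children q))).
apply: subset_leq_card; apply/subsetP=> c; rewrite inE => /andP[cNK /eqP pc].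
have [|x kx [tx nx]] := child_key cNK; first by rewrite pc.
by apply/imsetP; exists x; rewrite // inE kx nx pc eqxx.
Qed.

(** The top node of [v] stays in the segment because no other mark covers [v]; the subtree does not
    go below [q] because the bag of the only child misses [v]. *)
Lemma private_seg q v c : key M s q -> #|children q| = 1 -> c \in children q ->
  v \in bag q -> v \notin bag c -> (forall z, z \in M -> v \in bag z -> z = q) ->
  seg q (top_node v) /\ forall z, node z -> v \in bag z -> anc q z.
Proof.
move=> kq /eqP/cards1P[c0 chq] cq vq vc only.
have nq := M_node (key_M kq); have qv := bag_anc_top nq vq.
have sv : seg q (top_node v).
  apply/segP; split=> // [|z zM qz zv]; last first.
    by apply: only => //; apply: bag_between qz zv.
  rewrite /top_node; case: ifP => [vK|->//].
  have sq : s = q by apply: only; rewrite ?root_M // /bag sK.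
  by have := key_notK kq; rewrite -sq sK.
split=> // z nz vz; have zv := bag_anc_top nz vz.
case: (seg_comparable kq sv zv) => // /anc_last[->|[d pd zd]]; first exact: anc_refl.
have dK : d \notin K.
  by apply: contraNN (key_notK kq) => dK; rewrite -pd parent_K.
have dq : d \in children q by rewrite inE dK pd eqxx.
rewrite chq !inE in cq dq; move: vc; rewrite (eqP cq) -(eqP dq) => /negP[].
apply: (bag_between nz vz zd); apply: anc_trans qv.
by rewrite -pd anc_parent.
Qed.

(** * Selecting half of the cuts by a bottom-up sweep *)

Section Counting.

Variables (F : {set T}) (cut : T -> T).
Hypothesis F_key : forall q, q \in F -> key M s q.
Hypothesis cut_seg : forall q, q \in F -> seg q (cut q).

(** [g] witnesses that the part of the tree directly below the cut [a] contains the whole subtree of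
    a vertex. *)
Definition private (A : {set T}) (g a : T) : Prop :=
  [/\ anc (top_node g) a,
      forall z, z \in A -> anc (top_node g) z -> rk a <= rk z &
      forall z, z \in A -> g \notin later z].

Definition unseparated (A : {set T}) (g : T) : Prop :=
  forall z, z \in A -> ~~ anc (top_node g) z /\ g \notin later z.

(** The sweep line at rank [k] crosses the segment of [q]. *)
Definition opened (k : nat) (q : T) : bool :=
  key M s q && (rk q < k <= rk (next_mark q)).

(* The invariant of a bottom-up sweep over the marks of rank below [k]: [A] is
   the set of accepted cuts, and [L] the set of marks whose open part of the
   tree still contains a whole vertex [g].  A cut is accepted when the part
   below it contains such a vertex. *)
Definition sweep (k : nat) (A L : {set T}) : Prop :=
  [/\ forall a, a \in A -> exists2 q, q \in F & rk q < k /\ a = cut q,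
      forall a, a \in A -> exists g, private A g a,
      forall q, q \in L -> opened k q ->
        exists2 g, anc (top_node g) (seg_top q) & unseparated A g &
      #|[set q in F | rk q < k]| + #|[set q | opened k q && (q \notin L)]|
        <= 2 * #|A|].

(** At [q] the segments of its mark children close and its own opens; an open segment is dead if its
    mark is not in [L]. An accepted cut pays 2: for [q] in [F] and for its segment, now dead. After
    a rejection, closing dead children must pay for [q] in [F] and for its segment if that is left
    dead. *)
Lemma sweep_step_key k A L q : key M s q -> rk q = k -> sweep k A L ->
  exists A' L', sweep k.+1 A' L'.
Proof.
move=> kq rq [Acut Apriv Lg cnt].
have qM := key_M kq; have qK := key_notK kq; have nq := M_node qM.
have [qt mM] := seg_topP kq; have rm := rk_next_mark kq.
(* Accepted cuts lie in segments of marks of smaller rank, hence never at or above [q]. *)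
have f1 z : z \in A -> ~ anc q z.
  move=> /Acut[q' q'F [rq' ->]] qz.
  by have := anc_rk (seg_mark (F_key q'F) (cut_seg q'F) qM qz); move: rq' rq; clear; lia.
have rk_uniq x : key M s x -> rk x = k -> x = q.
  move=> kx rx; apply: rk_inj; rewrite ?inE ?(key_notK kx) //; by rewrite rx rq.
have Fk : #|[set x in F | rk x < k.+1]| = (q \in F) + #|[set x in F | rk x < k]|.
  have -> : [set x in F | rk x < k] = [set x in F | rk x < k.+1] :\ q.
    apply/setP=> x; rewrite !inE; case: (boolP (x \in F)) => xF /=; last by rewrite andbF.
    have [->|xq] := eqVneq x q; first by rewrite rq ltnn.
    rewrite [RHS]ltnS [RHS]leq_eqVlt; case: eqP => //= rx.
    by rewrite (rk_uniq x (F_key xF) rx) eqxx in xq.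
  by rewrite (cardsD1 q) !inE rq ltnSn andbT.
pose ch := mark_children q.
have open_step x : opened k.+1 x = (x == q) || opened k x && (x \notin ch).
  rewrite /opened /ch inE; have [->|xq] /= := eqVneq x q.
    by rewrite kq rq ltnSn /= -rq.
  case: (boolP (key M s x)) => //= kx; rewrite ltnS leq_eqVlt.
  have -> /= : (rk x == k) = false.
    by apply/negbTE; apply: contraNneq xq => rx; rewrite (rk_uniq x kx rx).
  case: (ltnP (rk x) k) => //= _; rewrite ltn_neqAle andbC; congr (_ && ~~ _).
  apply/eqP/eqP=> [kn|->//].
  have [_ nM] := seg_topP kx; have [ns|ns] := eqVneq (next_mark x) s.
    by move: qK; rewrite -rk_lt rq kn ns (rk_K sK) ltnn.
  by apply: rk_uniq; rewrite // /key nM.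
have ch_open x : x \in ch -> opened k x.
  rewrite inE => /andP[kx /eqP nx]; have := rk_next_mark kx.
  by rewrite /opened kx nx rq leqnn andbT.
pose dead (L' : {set T}) k' := #|[set x | opened k' x && (x \notin L')]|.
have dead_step L' : L' :\ q = L :\ q ->
    dead L' k.+1 + #|ch :\: L| <= dead L k + (q \notin L').
  move=> eqL; pose D := [set x | opened k x && (x \notin L)].
  have chD : ch :\: L \subset D.
    by apply/subsetP=> x; rewrite !in_setD [in X in _ -> X]inE => /andP[-> /ch_open->].
  have := cardsID (ch :\: L) D; rewrite (setIidPr chD) -/(dead L k) => <-.
  rewrite {1}/dead (cardsD1 q) inE open_step eqxx /=.
  suff : [set x | opened k.+1 x && (x \notin L')] :\ q \subset D :\: (ch :\: L).
    by move/subset_leq_card; clear; lia.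
  apply/subsetP=> x; rewrite in_setD1 inE open_step => /andP[xq].
  rewrite (negPf xq) /= => /andP[/andP[ox xch] xL'].
  have xL : x \notin L by move/setP/(_ x): eqL; rewrite !in_setD1 xq /= => <-.
  by rewrite in_setD in_setD (negPf xch) andbF inE ox xL.
have nch : #|children q| <= #|ch| by apply: card_mark_children.
have dLq : L :\ q :\ q = L :\ q by rewrite setDDl setUid.
have uLq : (q |: L) :\ q = L :\ q by rewrite setDUl setDv set0U.
have accept : q \in F ->
    (exists2 g, anc (top_node g) (cut q) & unseparated A g) ->
    exists A' L', sweep k.+1 A' L'.
  move=> qF [g gy gA]; set y := cut q in gy.
  have qy := cut_seg qF; rewrite -/y in qy; have /segP[yK aqy _] := qy.
  have yA : y \notin A by apply/negP=> /f1.
  exists (y |: A), (L :\ q); split.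
  - move=> a /setU1P[->|/Acut[x xF [rx ->]]]; first by exists q; rewrite // rq.
    by exists x => //; split=> //; apply: ltnW.
  - move=> a /setU1P[->|aA].
      exists g; split=> // z /setU1P[->//|zA].
      + by case: (gA z zA) => /negPf->.
      + apply/negP; rewrite inE => /andP[_ yg]; have := anc_rk gy.
        by rewrite rk_top_node; move: yg; clear; lia.
      + by case: (gA z zA).
    have [h [ha hmin hl]] := Apriv a aA; exists h; split=> // z /setU1P[->|zA].
    + move=> hy; case: (anc_total ha hy) => [/anc_rk//|ya].
      by case: (f1 a aA); apply: anc_trans ya.
    + exact: hmin.
    + apply/negP=> hly; case: (f1 a aA); apply: anc_trans aqy _.
      apply: anc_trans ha; apply: bag_anc_top; first by rewrite /node yK.
      exact: later_bag.
    + exact: hl.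
  - move=> x; rewrite in_setD1 open_step => /andP[xq xL].
    rewrite (negPf xq) /= => /andP[ox xch].
    have [h hx hA] := Lg x xL ox; exists h => // z /setU1P[->|/hA//].
    have /and3P[kx rx kn] := ox; have [/segP[txK axt _] _] := seg_topP kx.
    have notbelow : ~ anc q (seg_top x).
      move=> qtx; have [tx _] := seg_topP kx.
      by have := anc_rk (seg_mark kx tx qM qtx); move: rx rq; clear; lia.
    split; apply/negP.
      move=> hy; case: (anc_total hx hy) => [ty|yt]; last first.
        by apply: notbelow; apply: anc_trans yt.
      have xq' := seg_mark kq qy (key_M kx) (anc_trans axt ty).
      have qx : q != x by rewrite eq_sym.
      have nq' := next_mark_least kx qM xq' qx.
      have : next_mark x != q by apply: contraNneq xch => nxq; rewrite inE kx nxq eqxx.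
      move/eqP; apply; have [_ nxM] := seg_topP kx.
      have nxK : next_mark x \notin K by apply: anc_notK nq' qK.
      by apply: (anc_rk_eq nxK nq'); rewrite rq.
    move=> hly; apply: notbelow; apply: anc_trans aqy _; apply: anc_trans hx.
    by apply: bag_anc_top; [rewrite /node yK|apply: later_bag].
  - rewrite Fk qF cardsU1 yA; have := dead_step (L :\ q).
    rewrite -/(dead (L :\ q) k.+1) => /(_ dLq).
    by move: cnt; rewrite -/(dead L k); clear; lia.
have reject_alive :
    (exists2 g, anc (top_node g) (seg_top q) & unseparated A g) ->
    (q \in F) <= #|ch :\: L| -> exists A' L', sweep k.+1 A' L'.
  case=> g gt gA le; exists A, (q |: L); split=> //.
  - by move=> a /Acut[x xF [rx ->]]; exists x => //; split=> //; apply: ltnW.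
  - move=> x; rewrite in_setU1 open_step.
    have [->|xq] /= := eqVneq x q; first by exists g.
    by move=> xL /andP[ox _]; apply: Lg.
  - have := dead_step (q |: L). move=> /(_ uLq).
    by rewrite setU11; move: cnt le; rewrite Fk -/(dead L k) -/(dead _ k.+1); clear; lia.
have reject_dead : (q \in F) < #|ch :\: L| -> exists A' L', sweep k.+1 A' L'.
  move=> lt; exists A, (L :\ q); split=> //.
  - by move=> a /Acut[x xF [rx ->]]; exists x => //; split=> //; apply: ltnW.
  - move=> x; rewrite in_setD1 open_step => /andP[/negPf->] /= xL /andP[ox _].
    exact: Lg.
  - have := dead_step (L :\ q). move=> /(_ dLq).
    rewrite in_setD1 eqxx /=; move: cnt lt.
    by rewrite Fk -/(dead L k) -/(dead _ k.+1); clear; lia.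
have alive : (exists2 g, anc (top_node g) q & unseparated A g) ->
    exists A' L', sweep k.+1 A' L'.
  case=> g gq gA; have [qF|qF] := boolP (q \in F).
    have /segP[_ qy _] := cut_seg qF.
    by apply: accept => //; exists g => //; apply: anc_trans qy.
  have /segP[_ aqt _] := qt.
  by apply: reject_alive; rewrite ?(negPf qF) //; exists g => //; apply: anc_trans aqt.
(* At a leaf, the subtree of the vertex [q] is the single node [q]. *)
have [ch0|ch_gt0] := posnP #|children q|.
  apply: alive; exists q; first by rewrite /top_node (negPf qK) anc_refl.
  move=> z zA; split; first by rewrite /top_node (negPf qK); apply/negP/f1.
  apply/negP=> qz; have [q' q'F [_ zq']] := Acut z zA.
  have /segP[zK _ _] := cut_seg q'F; rewrite -zq' in zK.
  have nz : node z by rewrite /node zK.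
  have /anc_last := bag_anc_top nz (later_bag zK qz).
  rewrite /top_node (negPf qK) => -[zq|[c pc zc]].
    by move: qz; rewrite zq inE e_irr.
  have : c \in children q.
    rewrite inE pc eqxx andbT; apply: contraNN qK => cK'; by rewrite -pc parent_K.
  by rewrite (cards0_eq ch0) inE.
have [/set0Pn[x]|/negPn/eqP chL] := boolP (ch :&: L != set0).
  rewrite inE => /andP[xch xL]; apply: alive.
  have [g gx gA] := Lg x xL (ch_open x xch); exists g => //.
  apply: anc_trans gx _; move: xch; rewrite inE => /andP[_ /eqP<-].
  exact: anc_parent.
have chD : #|ch :\: L| = #|ch| by rewrite cardsD chL cards0 subn0.
have [ch1|ch2] := eqVneq #|children q| 1; last first.
  by apply: reject_dead; rewrite chD; move: nch ch_gt0 ch2; case: (q \in F); clear; lia.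
have [qF|qF] := boolP (q \in F); last first.
  by apply: reject_dead; rewrite chD (negPf qF); move: nch ch_gt0; clear; lia.
(* A single dead child pays for one unit only. The subtree of the private vertex [v] lies in the
   segment: if the cut separates [v], it is rejected and [v] keeps the segment alive; otherwise [v]
   lies below the cut, which is accepted. *)
have [v [c [cq vq vc only]]] := M_private qM qK ch1.
have [sv above] := private_seg kq ch1 cq vq vc only.
have qv : anc q (top_node v) by case/segP: sv.
have vA : unseparated A v.
  move=> z zA; split.
    by apply/negP=> vz; apply: (f1 z zA); apply: anc_trans vz.
  apply/negP=> vz; have [q' q'F [_ zq']] := Acut z zA.
  have /segP[zK _ _] := cut_seg q'F; rewrite -zq' in zK.
  by apply: (f1 z zA); apply: above; rewrite ?/node ?zK // later_bag.
have [vy|vy] := boolP (v \in later (cut q)).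
  apply: reject_alive; first by exists v => //; apply: seg_anc_top.
  by rewrite chD qF; move: nch ch_gt0; clear; lia.
apply: accept => //; exists v => //.
have /segP[yK qy _] := cut_seg qF.
have [//|yv] := anc_total qv qy.
have [->|neq] := eqVneq (cut q) (top_node v); first exact: anc_refl.
have vby := bag_between nq vq qy yv.
have ny : node (cut q) by rewrite /node yK.
by have [_] := bag_later ny vby neq; rewrite (negPf vy).
Qed.

Lemma sweep_exists k : exists A L, sweep k A L.
Proof.
elim: k => [|k [A [L swp]]].
  exists set0, set0; split=> [a|a|q|]; rewrite ?inE //.
  have -> : [set q in F | rk q < 0] = set0.
    by apply/setP=> x; rewrite !inE andbF.
  have -> : [set q | opened 0 q && (q \notin set0)] = set0.
    by apply/setP=> x; rewrite !inE /opened andbF.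
  by rewrite cards0.
have [/existsP[q /andP[kq /eqP rq]]|] := boolP [exists q, key M s q && (rk q == k)].
  exact: (sweep_step_key kq rq swp).
rewrite negb_exists => /forallP noq; case: swp => Acut Apriv Lg cnt.
have lt_step x : key M s x -> (rk x < k.+1) = (rk x < k).
  by move=> kx; have := noq x; rewrite kx /= ltnS leq_eqVlt => /negPf->.
have opened_step x : opened k.+1 x -> opened k x.
  case/and3P=> kx rx kn; apply/and3P; split=> //; last exact: ltnW.
  by rewrite -lt_step.
exists A, L; split=> //.
- by move=> a /Acut[x xF [rx ->]]; exists x => //; split=> //; apply: ltnW.
- by move=> q qL /opened_step; apply: Lg.
- apply: leq_trans cnt; apply: leq_add; apply: subset_leq_card; apply/subsetP=> x.
    by rewrite !inE => /andP[xF]; rewrite lt_step ?xF //; apply: F_key.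
  by rewrite !inE => /andP[/opened_step-> ->].
Qed.

(** The sweep at rank [n] has passed every mark except the root. *)
Lemma accepted_cuts : exists A : {set T},
  [/\ forall a, a \in A -> exists2 q, q \in F & a = cut q,
      forall a, a \in A -> exists g, private A g a & #|F| <= 2 * #|A|].
Proof.
have [A [L [Acut Apriv _ cnt]]] := sweep_exists n; exists A; split=> //.
  by move=> a /Acut[q qF [_ ->]]; exists q.
apply: leq_trans cnt; rewrite (_ : [set q in F | rk q < n] = F) ?leq_addr //.
apply/setP=> x; rewrite inE; case: (boolP (x \in F)) => //= xF.
by rewrite rk_lt (key_notK (F_key xF)).
Qed.

End Counting.

(** * Components left by the accepted separators *)

Section Components.

Variable A : {set T}.
Hypothesis A_notK : forall a, a \in A -> a \notin K.
Hypothesis A_private : forall a, a \in A -> exists g, private A g a.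

Definition separator : {set T} := \bigcup_(a in A) later a.

Definition cuts_above (x : T) : {set T} := [set z in A | anc x z].

(** Climbing to the top node of [v] passes no cut: below that node, [v] lies in [later] of each node
    passed. *)
Lemma cuts_above_top x v : node x -> v \in bag x -> v \notin separator ->
  cuts_above x = cuts_above (top_node v).
Proof.
move=> nx vx vS; have [k] := ubnP (n - rk x).
elim: k x nx vx => // k IH x nx vx; rewrite ltnS => kx.
have [->//|xt] := eqVneq x (top_node v).
have [xK vl] := bag_later nx vx xt.
have xA : x \notin A by apply: contraNN vS => xA; apply/bigcupP; exists x.
rewrite -(IH (parent x) (node_parent x) (later_bag_parent xK vl)); last first.
  by have := rk_parent xK; have := rk_le (parent x); move: kx; clear; lia.
apply/setP=> z; rewrite !inE; case: (boolP (z \in A)) => //= zA.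
apply/idP/idP=> [/anc_first[xz|//]|]; last exact: anc_trans (anc_parent x).
by rewrite xz zA in xA.
Qed.

Lemma cuts_above_edge u v : u \notin separator -> v \notin separator -> e u v ->
  cuts_above (top_node u) = cuts_above (top_node v).
Proof.
have wlg x y : y \notin separator -> e x y -> rk x < rk y ->
    cuts_above (top_node x) = cuts_above (top_node y).
  move=> yS exy /(adj_later exy)[xK yx].
  have -> : top_node x = x by rewrite /top_node (negPf xK).
  by apply: cuts_above_top; rewrite /node ?xK // later_bag.
move=> uS vS euv; case: (ltngtP (rk u) (rk v)) => [uv|vu|uv].
- exact: wlg.
- by apply/esym/wlg; rewrite // e_sym.
have [uK|uK] := boolP (u \in K); have [vK|vK] := boolP (v \in K).
- by rewrite /top_node uK vK.
- by move: vK; rewrite -rk_lt -uv (rk_K uK) ltnn.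
- by move: uK; rewrite -rk_lt uv (rk_K vK) ltnn.
- by have uv' := rk_inj _ _ uv; rewrite uv' ?inE // e_irr in euv.
Qed.

Lemma connect_cuts_above u v : connect (del_vertices e separator) u v ->
  cuts_above (top_node u) = cuts_above (top_node v).
Proof.
case/connectP=> p; elim: p u => [|w p IH] u /=; first by move=> _ ->.
case/andP=> /and3P[uS wS euw] pw lv; rewrite (cuts_above_edge uS wS euw).
exact: IH.
Qed.

(** The set of cuts above the top node is constant on components. For a vertex private to [a] its
    lowest member is [a], and for [s] it is empty, so these vertices lie in distinct components. *)
Lemma components_separator : #|A| < components_del e separator.
Proof.
pose r := del_vertices e separator.
have r_sym : connect_sym r.
  by apply: sym_connect_sym => x y; rewrite /r /del_vertices /= e_sym andbCA.
have [g gP] : exists g : T -> T, forall a, a \in A -> private A (g a) a.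
  apply: (@fin_all_exists _ _ (fun a g => a \in A -> private A g a)) => a.
  by case: (boolP (a \in A)) => [/A_private[g]|_]; [exists g|exists a].
have sS : s \notin separator.
  apply/negP=> /bigcupP[a aA]; rewrite inE => /andP[eas _].
  by have := A_notK aA; rewrite sN // e_sym.
have gS a : a \in A -> g a \notin separator.
  move=> aA; have [_ _ gl] := gP a aA.
  by apply/negP=> /bigcupP[z /gl/negPf->].
have rootS x : x \notin separator -> fingraph.root r x \notin separator.
  move=> xS; have /connectP[p] := connect_root r x.
  case/lastP: p => [|p y] /=; first by move=> _ ->.
  by rewrite rcons_path last_rcons => /andP[_ /and3P[_ yS _]] ->.
have root_cuts x y : fingraph.root r x = fingraph.root r y ->
    cuts_above (top_node x) = cuts_above (top_node y).
  by move=> /eqP; rewrite (root_connect r_sym) => /connect_cuts_above.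
have inj : {in A &, injective (fun a => fingraph.root r (g a))}.
  move=> a b aA bA /= /root_cuts eq_ab.
  have [ga amin _] := gP a aA; have [gb bmin _] := gP b bA.
  have ab : a \in cuts_above (top_node (g b)) by rewrite -eq_ab inE aA ga.
  have ba : b \in cuts_above (top_node (g a)) by rewrite eq_ab inE bA gb.
  move: ab ba; rewrite !inE aA bA /= => ab ba.
  apply: rk_inj; rewrite ?inE ?A_notK //; apply/eqP.
  by rewrite eqn_leq amin // bmin.
pose X := fingraph.root r s |: [set fingraph.root r (g a) | a in A].
have cX : #|X| = #|A|.+1.
  rewrite cardsU1 (card_in_imset inj); case: imsetP => // -[a aA /root_cuts eq_sa].
  have [ga _ _] := gP a aA.
  have : a \in cuts_above (top_node (g a)) by rewrite inE aA ga.
  rewrite -eq_sa inE /top_node sK => /andP[_ /anc_root as_].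
  by have := A_notK aA; rewrite as_ sK.
rewrite -cX /components_del /n_comp_mem; apply: subset_leq_card.
apply/subsetP=> x xX; rewrite !inE.
have [y yS ->] : exists2 y, y \notin separator & x = fingraph.root r y.
  case/setU1P: xX => [->|/imsetP[a aA ->]]; first by exists s.
  by exists (g a) => //; apply: gS.
by rewrite rootS // andbT; apply: roots_root.
Qed.

End Components.

End Segments.

End EliminationTree.

(** * Toughness and the conclusion *)

Lemma tough_separating (T : finType) (e : rel T) (t : nat) (S : {set T}) :
  tough e t%:R%R -> ~~ complete_graph e -> separating e S ->
  t * components_del e S <= #|S|.
Proof.
rewrite /tough /toughness => tgh /negPf nc sep; rewrite nc in tgh.
have : (t%:R%R%:E <= (#|S|%:R / (components_del e S)%:R)%R%:E :> \bar rat)%E.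
  apply: Order.POrderTheory.le_trans tgh _; exact: Order.TotalTheory.bigmin_le_cond.
rewrite lee_fin Num.Theory.ler_pdivlMr ?Num.Theory.ltr0n; last exact: ltnW.
by rewrite -GRing.natrM Num.Theory.ler_nat.
Qed.

Theorem mainTheorem2 (T : finType) (e : rel T)
    (e_sym : symmetric e) (e_irr : irreflexive e)
    (e_chordal : chordal e) (e_tough : tough e 10%:R%R) :
  hamilton_connected e.
Proof.
move=> u0 v0 uv.
have [||s _ cs] := @simplicial_exists T e e_sym e_irr e_chordal [set: T] set0.
- by apply/properP; split; [exact: sub0set|exists u0; rewrite !inE].
- by move=> x y; rewrite inE.
pose K := s |: [set w | e s w].
have sK : s \in K by rewrite setU11.
have sN x : e s x -> x \in K by rewrite !inE => ->; rewrite orbT.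
have cK : clique e K.
  move=> x y /setU1P[->|xs] /setU1P[->|ys] xy.
  - by rewrite eqxx in xy.
  - by move: ys; rewrite inE.
  - by move: xs; rewrite inE e_sym.
  - by apply: cs => //; rewrite inE in_setT; move: xs ys; rewrite !inE.
have [rk [n [rk_le rk_lt rk_inj later_clique]]] :=
  elimination_order e_sym e_irr e_chordal cK.
have [M markM privM] := marking_exists e sK rk_le rk_lt.
pose bg := bag e K rk; pose nm := next_mark e K s rk M.
pose I := {q : T | key M s q}.
pose ends := [set u0; v0].
pose E (i : I) (g : {set T}) := exists v w, [/\ g = [set v; w],
  v \in bg (val i), w \in bg (nm (val i)), v = w \/ e v w &
  (v \notin ends) && (w \notin ends)].
have E_card i g : E i g -> 0 < #|g| <= 2.
  by case=> v [w [-> _ _ _ _]]; rewrite cards2; case: (v != w).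
have E_free (J : {set I}) (W : {set T}) : J != set0 -> #|W| + 3 <= 5 * #|J| ->
    exists i g, [/\ i \in J, E i g & [disjoint g & W]].
  (* With the ends added, [W'] meets every linkage that is not allowed or not disjoint from [W]. *)
  move=> J0 cW; pose W' := W :|: ends.
  have [/exists_inP[i iJ /existsP[v /existsP[w]]]|] := boolP [exists i in J,
      exists v, exists w, [&& v \in bg (val i), w \in bg (nm (val i)),
        (v == w) || e v w, v \notin W' & w \notin W']].
    case/and5P=> vB wB vw vW' wW'.
    have /norP[vW vE] : ~~ ((v \in W) || (v \in ends)) by rewrite -in_setU.
    have /norP[wW wE] : ~~ ((w \in W) || (w \in ends)) by rewrite -in_setU.
    exists i, [set v; w]; split=> //.
      exists v, w; split=> //; last by rewrite vE wE.
      by case/orP: vw => [/eqP|]; [left|right].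
    by rewrite disjoints_subset; apply/subsetP=> x; rewrite !inE => /orP[]/eqP->.
  rewrite negb_exists_in => /forall_inP no.
  pose F := [set val i | i in J].
  have F_key q : q \in F -> key M s q by case/imsetP=> i _ ->; apply: (valP i).
  have [cut cutP] : exists cut : T -> T, forall q, q \in F ->
      seg e K s rk M q (cut q) && (later e rk (cut q) \subset W').
    apply: (@fin_all_exists _ _ (fun q y => q \in F ->
      seg e K s rk M q y && (later e rk y \subset W'))) => q.
    have [/imsetP[i iJ ->]|_] := boolP (q \in F); last by exists q.
    have [|y qy yW] := cut_of_hitting e_sym sK cK rk_le rk_lt rk_inj later_clique
      markM (W := W') (valP i).
      move=> v w vB wB vw; have := no i iJ; rewrite negb_exists => /forallP/(_ v).
      rewrite negb_exists => /forallP/(_ w); rewrite vB wB /=.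
      have -> /= : (v == w) || e v w by case: vw => ->; rewrite ?eqxx ?orbT.
      by rewrite negb_and !negbK.
    by exists y; rewrite qy yW.
  have [|A [Acut Apriv cA]] := accepted_cuts e_irr sK rk_le rk_lt rk_inj
    later_clique markM privM F_key (cut := cut).
    by move=> q /cutP/andP[].
  have A_notK a : a \in A -> a \notin K.
    by case/Acut=> q /cutP/andP[/and3P[yK _ _] _] ->.
  have cF : #|F| = #|J| by rewrite card_imset //; apply: val_inj.
  have J_gt0 : 0 < #|J| by rewrite card_gt0.
  have cmp := components_separator e_sym e_irr sK sN rk_le rk_lt rk_inj
    later_clique A_notK Apriv.
  have SW : separator e rk A \subset W'.
    by apply/bigcupsP=> a /Acut[q /cutP/andP[_ yW] ->].
  (* A cut lies outside [K] and so is not adjacent to [s]. *)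
  have nc : ~~ complete_graph e.
    have /card_gt0P[a aA] : 0 < #|A| by lia.
    have aK := A_notK a aA; apply/negP=> /forallP/(_ s)/forallP/(_ a)/implyP h.
    have as_ : s != a by apply: contraNneq aK => <-.
    by case/negP: aK; apply/sN/h.
  have sep : separating e (separator e rk A) by rewrite /separating; lia.
  have tgh := tough_separating e_tough nc sep.
  have cSW := subset_leq_card SW.
  have cends : #|ends| <= 2 by rewrite cards2; case: (_ != _).
  have cW' : #|W'| <= #|W| + #|ends| := (leq_card_setU W ends).1.
  (* From [10 * #|A| + 10 <= #|W'| <= #|W| + 2] and [#|J| <= 2 * #|A|] follows
     [5 * #|J| + 8 <= #|W|], against the bound on [#|W|]. *)
  by move: tgh cmp cSW cends cW' cW cA; rewrite cF; clear; lia.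
have [A [AE Adisj]] := double_representatives E_card E_free.
pose Lk (k : T * bool) := if insub k.1 is Some i then A (i, k.2) else set0.
have LkE q b (kq : key M s q) : Lk (q, b) = A (Sub q kq : I, b).
  by rewrite /Lk /= insubT.
apply: (@hamilton_of_linkages T e bg M s nm rk Lk u0 v0) => //.
- exact: root_M markM.
- by move=> q kq; have [] := seg_topP sK rk_le rk_lt markM kq.
- by move=> q kq; apply: rk_next_mark.
- by move=> x _; apply: bag_clique.
- by move=> v; apply: M_hit markM v.
- move=> q b kq; rewrite LkE; have [v [w [-> vB wB vw _]]] := AE (Sub q kq : I, b).
  by exists v, w.
- move=> [q b] [q' b'] /= kq kq' neq; rewrite !LkE; apply: Adisj.
  by apply: contraNneq neq => -[-> ->].
- move=> [q b] /= kq; rewrite !LkE.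
  have [v [w [-> _ _ _ /andP[]]]] := AE (Sub q kq : I, b).
  rewrite !inE !negb_or [v == u0]eq_sym [v == v0]eq_sym [w == u0]eq_sym
    [w == v0]eq_sym => /andP[-> ->] /andP[-> ->] //.
Qed.
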